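(* Assume that $F:\Omega\times X\to\mathbb{R}^m$ is continuous, of class $C^1$ with respect to the second variable, that $F(\Omega\times X_1)$ is bounded in $\mathbb{R}^m$ for every bounded set $X_1\subset X$, that $$F(\omega,\psi)-F(\omega,\phi)\geq B\,(\psi(0)-\phi(0))\quad\text{whenever }\phi\leq_B\psi \text{ and }\omega\in\Omega,$$ and that $$F(\omega,\lambda\psi)\ge\lambda F(\omega,\psi)\quad\text{whenever }\psi\ge_B0,\ \lambda\in[0,1]\text{ and }\omega\in\Omega.$$ Then the semiflow is globally defined on $\Omega\times K_B$ (i.e. $y_t(\omega,\psi)$ exists for all $t\ge0$, $\omega\in\Omega$, $\psi\in K_B$) and it is sublinear for the exponential ordering, that is, for each $\omega\in\Omega$, $\psi\ge_B0$ and $\lambda\in[0,1]$, $$y_t(\omega,\lambda\psi)\ge_B\lambda\,y_t(\omega,\psi)\quad\text{for all }t\ge0.$$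
   Context: $\Omega$ is a compact metric space with a continuous minimal flow $\mathbb{R}\times\Omega\to\Omega$, $(t,\omega)\mapsto\omega\cdot t$. Fix $r>0$, $m\ge 1$. $X=C([-r,0],\mathbb{R}^m)$ with the sup-norm. For a continuous $y:[-r,\infty)\to\mathbb{R}^m$ and $t\ge0$, $y_t\in X$ is $y_t(s)=y(t+s)$, $s\in[-r,0]$. For $y\in\mathbb{R}^m$, $y\ge0$ means all components are nonnegative; for $\phi\in X$, $\phi\ge0$ means $\phi(s)\ge0$ for all $s\in[-r,0]$. $B=[b_{ij}]$ is a fixed real $m\times m$ quasipositive matrix ($b_{ij}\ge0$ for $i\ne j$). The exponential ordering is given by the cone $K_B=\{\phi\in X\mid \phi\ge0,\ \phi(t)\ge e^{B(t-s)}\phi(s)\text{ for } -r\le s\le t\le0\}$: $\phi\le_B\psi$ iff $\psi-\phi\in K_B$. For $\omega\in\Omega$, $\varphi\in X$, $y(t,\omega,\varphi)$ denotes the (locally defined, unique) solution of $y'(t)=F(\omega\cdot t,y_t)$, $t\ge0$, with $y(s,\omega,\varphi)=\varphi(s)$ for $s\in[-r,0]$, and $y_t(\omega,\varphi)\in X$ is $y_t(\omega,\varphi)(s)=y(t+s,\omega,\varphi)$. The induced skew-product semiflow is $\tau(t,\omega,\varphi)=(\omega\cdot t,y_t(\omega,\varphi))$. *)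

(* Defs.v *)
From HB Require Import structures.
From mathcomp Require Import all_boot all_order all_algebra.
From mathcomp Require Import all_classical all_reals all_analysis.

Set Implicit Arguments.
Unset Strict Implicit.
Unset Printing Implicit Defensive.

Import Order.TTheory GRing.Theory Num.Theory.
Import numFieldNormedType.Exports.

Local Open Scope classical_set_scope.
Local Open Scope ring_scope.

(* The interval [-r, 0] as a type, with the subspace topology. *)
Notation delay_itv r := (set_type `[- r, 0]%classic).

Lemma delay0_subproof (R : realType) (r : R) :
  0 < r -> 0 \in (`[- r, 0]%classic : set R).
Proof. by move=> r0; rewrite inE /= in_itv /= lexx oppr_le0 ltW. Qed.

Definition delay0 (R : realType) (r : R) (hr : 0 < r) : delay_itv r :=
  exist _ 0 (delay0_subproof hr).

Section HistorySpace.
Context (R : realType) (r : R) (m : nat).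

Definition cts_history : {pred delay_itv r -> 'cV[R]_m} :=
  fun f => `[< continuous f >].

Lemma cts_historyP (f : delay_itv r -> 'cV[R]_m) :
  reflect (continuous f) (f \in cts_history).
Proof. exact: asboolP. Qed.

Lemma cts_history_submod_closed : submod_closed cts_history.
Proof.
split.
  by apply/cts_historyP; exact: (@cst_continuous _ _ (0 : 'cV[R]_m)).
move=> a f g /cts_historyP cf /cts_historyP cg.
apply/cts_historyP => s; apply: cvgD (cg s).
exact: (@cvgZl_tmp _ _ _ _ _ a f _ (cf s)).
Qed.

HB.instance Definition _ :=
  GRing.isSubmodClosed.Build R (delay_itv r -> 'cV[R]_m) cts_history
    cts_history_submod_closed.

(* X = C([-r, 0], R^m), with R^m the column vectors under the max norm. *)
Record history := History {
  history_fun :> delay_itv r -> 'cV[R]_m;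
  history_cts : history_fun \in cts_history }.

HB.instance Definition _ := [isSub for history_fun].
HB.instance Definition _ := [Choice of history by <:].
HB.instance Definition _ := [SubChoice_isSubLmodule of history by <:].

Definition history_norm (phi : history) : R :=
  sup (range (fun s : delay_itv r => `|phi s|)).

Lemma history_bounded (phi : history) :
  has_ubound (range (fun s : delay_itv r => `|phi s|)).
Proof.
have /cts_historyP cphi := history_cts phi.
have /subspace_valL_continuousP' cv : continuous phi by [].
have [M [_ MP]] :
    bounded_set (valL_ 0 phi @` (`[- r, 0]%classic : set R)).
  apply: compact_bounded; apply: continuous_compact; first exact: cv.
  exact: segment_compact.
exists (M + 1) => _ [s _ <-].
apply: (MP (M + 1)); first by rewrite ltrDl.
exists (val s); first by apply: set_mem; exact: valP s.
by rewrite -[in RHS](valLK 0 phi).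
Qed.

Lemma history_norm_ub (phi : history) (s : delay_itv r) :
  `|phi s| <= history_norm phi.
Proof. by apply: ub_le_sup; [exact: history_bounded|exists s]. Qed.

Lemma history_norm_le (phi : history) (M : R) :
  0 <= M -> (forall s, `|phi s| <= M) -> history_norm phi <= M.
Proof.
move=> M0 phiM; rewrite /history_norm.
have [[s _]|] := pselect (exists s : delay_itv r, True).
  by apply: ge_sup => [|_ [u _ <-]]; [exists (`|phi s|), s|exact: phiM].
move=> empty; rewrite [X in sup X](_ : _ = set0) ?sup0 //.
by apply/seteqP; split=> // x [s _ _]; case: empty; exists s.
Qed.

Lemma history_norm_ge0 (phi : history) : 0 <= history_norm phi.
Proof.
have [[s _]|empty] := pselect (exists s : delay_itv r, True).
  exact: le_trans (history_norm_ub phi s).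
rewrite /history_norm [X in sup X](_ : _ = set0) ?sup0 //.
by apply/seteqP; split=> // x [s _ _]; case: empty; exists s.
Qed.

Lemma history_normD (phi psi : history) :
  history_norm (phi + psi) <= history_norm phi + history_norm psi.
Proof.
apply: history_norm_le => [|s]; first by rewrite addr_ge0 ?history_norm_ge0.
by rewrite (le_trans (ler_normD _ _)) // lerD // history_norm_ub.
Qed.

Lemma history_normZ_le (l : R) (phi : history) :
  history_norm (l *: phi) <= `|l| * history_norm phi.
Proof.
apply: history_norm_le => [|s]; first by rewrite mulr_ge0 ?history_norm_ge0.
by rewrite normrZ ler_wpM2l // history_norm_ub.
Qed.

Lemma history_normZ (l : R) (phi : history) :
  history_norm (l *: phi) = `|l| * history_norm phi.
Proof.
apply/eqP; rewrite eq_le history_normZ_le /=.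
have [->|l0] := eqVneq l 0; first by rewrite normr0 mul0r history_norm_ge0.
rewrite -ler_pdivlMl ?normr_gt0 // -normfV.
by rewrite -[leLHS](congr1 history_norm (scalerK l0 phi)) history_normZ_le.
Qed.

Lemma history_norm_eq0 (phi : history) : history_norm phi = 0 -> phi = 0.
Proof.
move=> phi0; apply: val_inj; apply/funext => s.
by apply/eqP; rewrite -normr_le0 (le_trans (history_norm_ub phi s)) ?phi0.
Qed.

HB.instance Definition _ := @Lmodule_isNormed.Build R history
  history_norm history_normD history_normZ history_norm_eq0.

(* y_t; the default 0 is only reached if y is not continuous on [t - r, t]. *)
Definition segment (y : R -> 'cV[R]_m) (t : R) : history :=
  insubd 0 (fun s : delay_itv r => y (t + \val s)).

End HistorySpace.

Definition cv_le (R : realType) (m : nat) (u v : 'cV[R]_m) : Prop :=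
  forall i, u i 0 <= v i 0.

Definition quasipositive (R : realType) (m : nat) (B : 'M[R]_m) : Prop :=
  forall i j, i != j -> 0 <= B i j.

Definition expmx (R : realType) (m : nat) (A : 'M[R]_m) : 'M[R]_m :=
  limn (series (fun k => (k`!%:R)^-1 *: A ^+ k)).

Section ExponentialOrdering.
Context (R : realType) (r : R) (m : nat) (B : 'M[R]_m).

Definition exp_cone : set (history r m) := [set phi |
  (forall s, cv_le 0 (phi s)) /\
  (forall s t : delay_itv r, \val s <= \val t ->
     cv_le (expmx ((\val t - \val s) *: B) *m phi s) (phi t))].

Definition exp_le (phi psi : history r m) : Prop := exp_cone (psi - phi).

End ExponentialOrdering.

Section Flow.
Context (R : realType) (Omega : topologicalType) (flow : R -> Omega -> Omega).

Definition continuous_flow : Prop :=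
  [/\ continuous (fun p : R * Omega => flow p.1 p.2),
      forall w, flow 0 w = w &
      forall s t w, flow (s + t) w = flow t (flow s w)].

Definition minimal_flow : Prop :=
  forall K : set Omega, closed K -> K !=set0 ->
    (forall t, flow t @` K = K) -> K = setT.

End Flow.

Section DelayEquation.
Context (R : realType) (Omega : topologicalType) (r : R) (m : nat).
Variables (flow : R -> Omega -> Omega)
  (F : Omega -> history r m -> 'cV[R]_m).

(* The second condition is the continuity of (w, phi) |-> D_2 F(w, phi) for the
   operator norm. *)
Definition C1_snd : Prop :=
  (forall (w : Omega) (phi : history r m), differentiable (F w) phi) /\
  (forall (w0 : Omega) (phi0 : history r m) (e : R), 0 < e ->
     \forall w \near w0 & phi \near phi0, forall h : history r m,
       `|'d (F w) phi h - 'd (F w0) phi0 h| <= e * `|h|).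

(* Only the restriction of y to [-r, +oo[ matters; the derivative is two-sided
   at t > 0 and one-sided at t = 0. *)
Definition is_global_solution (w : Omega) (phi : history r m)
    (y : R -> 'cV[R]_m) : Prop :=
  [/\ {within `[- r, +oo[, continuous y},
      forall s : delay_itv r, y (\val s) = phi s &
      forall t : R, 0 <= t ->
        h^-1 *: (y (t + h) - y t) @[h --> within [set h | 0 <= t + h] 0^']
          --> F (flow t w) (segment r y t)].

End DelayEquation.

(* Main.v *)
(* Put G(w, phi) = F(w, phi) - B phi(0). The hypotheses make G monotone for the
   exponential ordering and nonnegative on the cone, and sublinearity bounds it
   above by C (1 + |phi|) there. Since B is quasipositive, a function d with
   d_0 in the cone and d' >= B d keeps d_t in the cone.

   Existence: the iterates y_{n+1}' = B y_{n+1} + G(w.t, (y_n)_t) with initial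
   history psi increase for the exponential ordering and are bounded on each
   [0, T], hence converge. A difference d of two iterates satisfies d' >= B d,
   so d_i(s) <= e^(b (t - s)) d_i(t) for s <= t: pointwise convergence at T is
   uniform convergence on [0, T], and the limit solves the equation.

   Sublinearity: if u' <= F(w.t, u_t), z is a solution and z_0 - u_0 is in the
   cone, then so is z_t - u_t. With u = 0 this shows that solutions starting in
   the cone stay there; then u = lam y is a sub-solution. *)

Require Import Defs.
From mathcomp Require Import all_boot all_order all_algebra.
From mathcomp Require Import all_classical all_reals all_analysis.
From mathcomp Require Import ring lra.

Set Implicit Arguments.
Unset Strict Implicit.
Unset Printing Implicit Defensive.

Import Order.TTheory GRing.Theory Num.Theory.
Import numFieldNormedType.Exports.

Local Open Scope classical_set_scope.
Local Open Scope ring_scope.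

(** * Componentwise calculus on column vectors *)

(** The obstacle is a circularity in the comparison: monotonicity of F concerns ordered pairs only,
    so for d = z - u the inequality d' >= B d, which would keep d_t in the cone, is known only once
    d_t is in the cone. Therefore d is replaced by a function that is in the cone by construction,
    and the local Lipschitz bound, which comes from the continuity of the derivative of F, shows
    that the two agree for a short time; an argument on the first time of failure then covers all
    times. Existence avoids the circle: each iterate solves a linear equation whose forcing is
    already known, so the order passes from one step to the next by induction. Continuity of F on an
    infinite-dimensional space gives no uniform continuity on bounded sets; compactness of the limit
    curve over [0, T] replaces it when the forcings pass to the limit. *)

Lemma mx_norm_le (R : realType) m n (x : 'M[R]_(m, n)) (e : R) : 0 <= e ->
  (forall i j, `|x i j| <= e) -> `|x| <= e.
Proof.
by move=> e0 xe; rewrite /Num.Def.normr/= mx_normrE (bigmax_le _ e0)//= => -[i j].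
Qed.

Lemma mx_entry_le (R : realType) m n (x : 'M[R]_(m, n)) i j : `|x i j| <= `|x|.
Proof. by rewrite [leRHS]/Num.Def.normr/= mx_normrE; exact: (le_bigmax _ _ (i, j)). Qed.

Lemma mx_cvgP (R : realType) (T : Type) (F : set_system T) (FF : Filter F) m n
    (f : T -> 'M[R]_(m, n)) (l : 'M[R]_(m, n)) :
  f x @[x --> F] --> l <-> forall i j, f x i j @[x --> F] --> l i j.
Proof.
split=> [fl i j|fl].
  apply/cvgrPdist_le => e e0; move/cvgrPdist_le: fl => /(_ _ e0).
  apply: filterS => x; apply: le_trans.
  by have := mx_entry_le (l - f x) i j; rewrite !mxE.
apply/cvgrPdist_le => e e0.
have : \forall x \near F, forall ij : 'I_m * 'I_n, `|l ij.1 ij.2 - f x ij.1 ij.2| <= e.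
  apply: filter_forall => ij.
  by move/cvgrPdist_le: (fl ij.1 ij.2) => /(_ _ e0).
apply: filterS => x H; apply: mx_norm_le; first exact: ltW.
by move=> i j; rewrite !mxE; exact: (H (i, j)).
Qed.

Lemma cv_norm_le (R : realType) m (x : 'cV[R]_m) (e : R) : 0 <= e ->
  (forall i, `|x i 0| <= e) -> `|x| <= e.
Proof. by move=> e0 xe; apply: mx_norm_le => // i j; rewrite ord1. Qed.

Lemma cv_cvgP (R : realType) (T : Type) (F : set_system T) (FF : Filter F) m
    (f : T -> 'cV[R]_m) (l : 'cV[R]_m) :
  f x @[x --> F] --> l <-> forall i, f x i 0 @[x --> F] --> l i 0.
Proof.
by split=> [/mx_cvgP fl i|fl]; [exact: fl|apply/mx_cvgP => i j; rewrite ord1].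
Qed.

Lemma cv_continuousP (R : realType) (T : topologicalType) m (f : T -> 'cV[R]_m) :
  continuous f <-> forall i, continuous (fun x => f x i 0).
Proof.
split=> [cf i x|cf x]; first by have /cv_cvgP := cf x; exact.
by apply/cv_cvgP => i; exact: cf.
Qed.

Lemma is_derive_cvP (R : realType) m (f : R -> 'cV[R]_m) (t : R) (l : 'cV[R]_m) :
  is_derive t 1 f l <-> forall i, is_derive t 1 (fun x => f x i 0) (l i 0).
Proof.
split=> [[df fl] i|H].
  split; first by have /derivable_mxP := df; apply.
  by rewrite -fl derive_mx// mxE.
have df : derivable f t 1.
  by apply/derivable_mxP => i j; rewrite ord1; have [] := H i.
split=> //; rewrite derive_mx//; apply/matrixP => i j; rewrite ord1 mxE.
by have [] := H i.
Qed.

Lemma is_derive_mulmx (R : realType) m n (M dM : R -> 'M[R]_(n, m))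
    (f : R -> 'cV[R]_m) (t : R) (df : 'cV[R]_m) :
  (forall i j, is_derive t 1 (fun x => M x i j) (dM t i j)) ->
  is_derive t 1 f df ->
  is_derive t 1 (fun x => M x *m f x) (dM t *m f t + M t *m df).
Proof.
move=> HM /is_derive_cvP Hf; apply/is_derive_cvP => i.
rewrite [X in is_derive _ _ X](_ : _ =
    \sum_(j < m) ((fun x => M x i j) * (fun x => f x j 0))); last first.
  by apply/funext => x; rewrite mxE fct_sumE.
rewrite !mxE -big_split/=; apply: is_derive_sum => j.
have H := is_deriveM (HM i j) (Hf j).
apply: (is_derive_eq H).
by rewrite /GRing.scale/=; ring.
Qed.

Lemma continuous_mulmx (R : realType) (T : topologicalType) m n
    (M : T -> 'M[R]_(n, m)) (f : T -> 'cV[R]_m) :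
  (forall i j, continuous (fun x => M x i j)) ->
  continuous f -> continuous (fun x => M x *m f x).
Proof.
move=> cM /cv_continuousP cf; apply/cv_continuousP => i x.
rewrite /continuous_at mxE; under eq_fun do rewrite mxE.
apply: cvg_big => [|j _]; first exact: add_continuous.
by apply: cvgM; [exact: cM|exact: cf].
Qed.

Lemma is_derive_continuous (R : realType) (V : normedModType R) (f : R -> V) (t : R) (l : V) :
  is_derive t 1 f l -> {for t, continuous f}.
Proof. by move=> [df _]; exact/differentiable_continuous/derivable1_diffP. Qed.

(** * Linear systems with a quasipositive matrix *)

(* Look at the minimum over [s, T] of all components of [expR (- b t) *: w t],
   with b larger than the row sums of B: if it were negative, the derivative
   there would be positive, although the values to its left are larger. *)
Lemma linear_comparison (R : realType) m (B : 'M[R]_m) (s T : R)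
    (w dw : R -> 'cV[R]_m) :
  quasipositive B -> continuous w ->
  (forall t, s < t <= T -> is_derive t 1 w (dw t)) ->
  (forall t, s < t <= T -> cv_le (B *m w t) (dw t)) ->
  cv_le 0 (w s) -> forall t, s <= t <= T -> cv_le 0 (w t).
Proof.
move=> qB cw Dw Bw ws t0 /andP[st0 t0T] i0.
rewrite leNgt; apply/negP; rewrite mxE => wneg.
pose b := 1 + \sum_i \sum_j `|B i j|.
have Bb i : \sum_j B i j < b.
  apply: (@le_lt_trans _ _ (\sum_i \sum_j `|B i j|)); last by rewrite ltrDr.
  apply: (@le_trans _ _ (\sum_j `|B i j|)).
    by apply: ler_sum => j _; exact: ler_norm.
  by rewrite [leRHS](bigD1 i)//= lerDl sumr_ge0// => k _; exact: sumr_ge0.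
pose v i t := expR (- b * t) * w t i 0.
have cv i : continuous (v i).
  move=> t; apply: cvgM; last by have /cv_continuousP := cw; apply.
  apply: continuous_comp; last exact: continuous_expR.
  exact: mulrl_continuous.
have sT : s <= T by exact: le_trans t0T.
have min i := EVT_min sT (continuous_subspaceT (cv i)).
have {}min i : exists c, c \in `[s, T]%R /\ forall t, t \in `[s, T]%R -> v i c <= v i t.
  by have [c ? ?] := min i; exists c.
pose c i := sval (cid (min i)).
have cI i : s <= c i <= T by have [] := svalP (cid (min i)); rewrite in_itv.
have cm i t : s <= t <= T -> v i (c i) <= v i t.
  by have [_] := svalP (cid (min i)) => + tI; apply; rewrite in_itv.
have [i _ im] := arg_minP (fun i => v i (c i)) (isT : xpredT i0).
have {}im j t : s <= t <= T -> v i (c i) <= v j t.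
  by move=> tI; apply: le_trans (im j isT) _; exact: cm.
have vneg : v i (c i) < 0.
  by apply: le_lt_trans (im i0 t0 _) _; rewrite ?st0// pmulr_rlt0// expR_gt0.
set t1 := c i in im vneg *.
have /andP[st1 t1T] : s <= t1 <= T by exact: cI.
(* The minimum is negative while [w s] is nonnegative, so it is attained after [s] and there is room
   on its left. *)
have st1' : s < t1.
  rewrite lt_neqAle st1 andbT; apply/eqP => E; move: vneg; rewrite -E ltNge.
  by rewrite mulr_ge0// ?expR_ge0//; have := ws i; rewrite mxE.
have t1I : s < t1 <= T by rewrite st1'.
have := Dw _ t1I => /is_derive_cvP/(_ i) Dwi.
pose l := expR (- b * t1) * (dw t1 i 0 - b * w t1 i 0).
have Dv : is_derive t1 1 (v i) l.
  have De : is_derive t1 1 (fun t => expR (- b * t)) (expR (- b * t1) * - b).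
    by apply: is_derive_eq; rewrite /GRing.scale/=; ring.
  by rewrite /v; apply: is_derive_eq; rewrite /l /GRing.scale/=; ring.
have lpos : 0 < l.
  rewrite mulr_gt0 ?expR_gt0// subr_gt0.
  apply: lt_le_trans (Bw _ t1I i); rewrite mxE.
  rewrite -subr_gt0 -(pmulr_rgt0 _ (expR_gt0 (- b * t1))) mulrBr mulr_sumr.
  have -> : expR (- b * t1) * (b * w t1 i 0) = b * v i t1 by rewrite /v; ring.
  (* The diagonal terms agree; off the diagonal [B i j] is nonnegative and [v j t1] is at least the
     minimum. *)
  have le : \sum_j B i j * v i t1 <= \sum_j expR (- b * t1) * (B i j * w t1 j 0).
    apply: ler_sum => j _; rewrite [leRHS]mulrCA.
    have [->//|ij] := eqVneq i j.
    by rewrite ler_wpM2l ?qB//; apply: (im j); rewrite st1.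
  (* What remains is (row sum - b) times [v i t1], a product of two negative numbers. *)
  apply: lt_le_trans (lerB le (lexx _)).
  by rewrite -mulr_suml -mulrBl nmulr_rgt0// subr_lt0.
have [dvi lE] := Dv.
have : h^-1 *: ((v i \o shift t1) (h *: 1) - v i t1) @[h --> 0^'-] --> l.
  rewrite -lE; apply: cvg_trans dvi; apply: cvg_app => A [e e0 Ae].
  by exists e => // x xe x0; apply: Ae => //; exact: ltr0_neq0.
move=> /cvgr_gt /(_ _ lpos) pos.
have : \forall h \near 0^'-, [/\ h < 0, s <= h + t1 &
    0 < h^-1 *: ((v i \o shift t1) (h *: 1) - v i t1)].
  near=> h; split; last by near: h.
    by near: h; exact: nbhs_left_lt.
  by rewrite -lerBlDr; near: h; apply: nbhs_left_ge; rewrite subr_lt0.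
move=> /filter_ex[h [h0 sh]]; rewrite /GRing.scale/= mulr1 nmulr_rgt0 ?invr_lt0//.
rewrite subr_lt0 => /lt_geF; rewrite /= im// sh/=; apply: le_trans t1T.
by rewrite gerDr ltW.
Unshelve. all: by end_near. Qed.

Lemma cv_subE (R : realType) m (x y : 'cV[R]_m) i : (x - y) i 0 = x i 0 - y i 0.
Proof. by rewrite !mxE. Qed.

(** * Entries of the matrix exponential as power series *)

Lemma mx_expr_entry_le (R : realType) m (B : 'M[R]_m) k i j :
  `|(B ^+ k) i j| <= (\sum_i \sum_j `|B i j|) ^+ k.
Proof.
set c := \sum_i _; have c0 : 0 <= c by do 2 apply: sumr_ge0 => ? _.
elim: k i j => [|k IH] i j.
  by rewrite !expr0 mxE; case: eqP; rewrite /= ?normr1 ?normr0.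
rewrite [B ^+ _]exprS mxE (le_trans (ler_norm_sum _ _ _))//.
apply: (@le_trans _ _ (\sum_l `|B i l| * c ^+ k)).
  by apply: ler_sum => l _; rewrite normrM ler_wpM2l.
rewrite -mulr_suml exprS ler_wpM2r ?exprn_ge0//.
by rewrite [leRHS](bigD1 i)//= lerDl sumr_ge0// => l _; exact: sumr_ge0.
Qed.

(** Coefficients of the power series in t of an entry of B^p e^(tB); the shift [p] is there because
    termwise differentiation raises it by one. *)
Definition expmx_coef (R : realType) m (B : 'M[R]_m) (i j : 'I_m) p : R^nat :=
  fun k => k`!%:R^-1 * (B ^+ (k + p)) i j.

Lemma pseries_diffs_expmx_coef (R : realType) m (B : 'M[R]_m) i j p :
  pseries_diffs (expmx_coef B i j p) = expmx_coef B i j p.+1.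
Proof.
apply/funext => k; rewrite /pseries_diffs /expmx_coef addSnnS factS natrM invfM.
by rewrite !mulrA mulfV ?mul1r// pnatr_eq0.
Qed.

Lemma is_cvg_expmx_coef (R : realType) m (B : 'M[R]_m) i j p (x : R) :
  cvgn (pseries (expmx_coef B i j p) x).
Proof.
set c := \sum_i \sum_j `|B i j|; have c0 : 0 <= c by do 2 apply: sumr_ge0 => ? _.
apply: normed_cvg.
apply: (@series_le_cvg _ _ (fun k => c ^+ p * exp_coeff (c * `|x|) k)).
- by move=> k; exact: normr_ge0.
- by move=> k; rewrite mulr_ge0 ?exprn_ge0// /exp_coeff /= divr_ge0 ?exprn_ge0// mulr_ge0.
- move=> k; rewrite /expmx_coef /exp_coeff /= !normrM normfV normrX.
  rewrite (ger0_norm (ler0n _ _)) exprMn.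
  have -> : c ^+ p * (c ^+ k * `|x| ^+ k / k`!%:R) =
    k`!%:R^-1 * c ^+ (k + p) * `|x| ^+ k by rewrite exprD; ring.
  by rewrite ler_wpM2r ?exprn_ge0// ler_wpM2l ?invr_ge0// mx_expr_entry_le.
- exact: is_cvg_seriesZ (is_cvg_series_exp_coeff _).
Qed.

Lemma mx_exprZn (R : realType) m (B : 'M[R]_m) (t : R) k :
  (t *: B) ^+ k = t ^+ k *: B ^+ k.
Proof.
elim: k => [|k IH]; first by rewrite !expr0 scale1r.
rewrite !exprS IH -[LHS]/((t *: B) *m (t ^+ k *: B ^+ k)).
by rewrite -scalemxAl -scalemxAr scalerA.
Qed.

Lemma expmx_entry (R : realType) m (B : 'M[R]_m) (t : R) :
  expmx (t *: B) = \matrix_(i, j) limn (pseries (expmx_coef B i j 0) t).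
Proof.
apply: cvg_lim => //; apply/mx_cvgP => i j; rewrite mxE.
rewrite [X in X @ _ --> _](_ : _ = pseries (expmx_coef B i j 0) t).
  exact: is_cvg_expmx_coef.
apply/funext => n; rewrite /series /pseries /= /series /= summxE; apply: eq_bigr => k _.
by rewrite /expmx_coef addn0 mx_exprZn !mxE; ring.
Qed.

Lemma mulmx_expmx_entry (R : realType) m (B : 'M[R]_m) (t : R) i j :
  (B *m expmx (t *: B)) i j = limn (pseries (expmx_coef B i j 1) t).
Proof.
apply/esym/cvg_lim => //; rewrite mxE expmx_entry.
rewrite [X in X @ _ --> _](_ : _ = fun n =>
    \sum_l B i l * pseries (expmx_coef B l j 0) t n).
  apply: cvg_big => [|l _]; first exact: add_continuous.
  rewrite mxE; apply: cvgMr; exact: is_cvg_expmx_coef.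
apply/funext => n; rewrite /pseries/series /=.
under [RHS]eq_bigr do rewrite mulr_sumr.
rewrite exchange_big/=; apply: eq_bigr => k _.
rewrite /expmx_coef addn0 addn1 exprS mxE mulr_sumr mulr_suml.
by apply: eq_bigr => l _; ring.
Qed.

Lemma expmx_mulmx_entry (R : realType) m (B : 'M[R]_m) (t : R) i j :
  (expmx (t *: B) *m B) i j = limn (pseries (expmx_coef B i j 1) t).
Proof.
apply/esym/cvg_lim => //; rewrite mxE expmx_entry.
rewrite [X in X @ _ --> _](_ : _ = fun n =>
    \sum_l pseries (expmx_coef B i l 0) t n * B l j).
  apply: cvg_big => [|l _]; first exact: add_continuous.
  rewrite mxE; apply: cvgMl; exact: is_cvg_expmx_coef.
apply/funext => n; rewrite /pseries/series /=.
under [RHS]eq_bigr do rewrite mulr_suml.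
rewrite exchange_big/=; apply: eq_bigr => k _.
rewrite /expmx_coef addn0 addn1 exprSr mxE mulr_sumr mulr_suml.
by apply: eq_bigr => l _; ring.
Qed.

Lemma expmx_comm (R : realType) m (B : 'M[R]_m) (t : R) :
  expmx (t *: B) *m B = B *m expmx (t *: B).
Proof. by apply/matrixP => i j; rewrite expmx_mulmx_entry mulmx_expmx_entry. Qed.

Lemma is_derive_expmx (R : realType) m (B : 'M[R]_m) (t : R) i j :
  is_derive t 1 (fun x => expmx (x *: B) i j) ((B *m expmx (t *: B)) i j).
Proof.
under eq_fun do rewrite expmx_entry mxE.
(* [|t| + 1] is just a point beyond [|t|] where the series and its first two formal derivatives
   converge. *)
have := @pseries_snd_diffs R (expmx_coef B i j 0) (`|t| + 1) t.
rewrite !pseries_diffs_expmx_coef; do 3 move=> /(_ (@is_cvg_expmx_coef _ _ _ _ _ _ _)).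
rewrite [X in _ < X]ger0_norm ?addr_ge0// ltrDl ltr01 => /(_ isT) H.
by apply: (is_derive_eq H); rewrite mulmx_expmx_entry.
Qed.

Lemma expmx0 (R : realType) m : expmx (0 : 'M[R]_m) = 1%:M.
Proof.
apply: cvg_lim => //; apply: (@cvg_near_cst _ _ (1%:M : 'M[R]_m)).
near=> n; rewrite /series /= -[n]prednK; last by near: n; exact: nbhs_infty_gt.
rewrite big_nat_recl//= fact0 invr1 scale1r expr0 big1 ?addr0// => k _.
by rewrite expr0n scaler0.
Unshelve. all: by end_near. Qed.

Lemma continuous_expmx (R : realType) m (B : 'M[R]_m) (a : R) i j :
  continuous (fun t => expmx ((t - a) *: B) i j).
Proof.
move=> t; apply: (@continuous_comp _ _ _ (fun t => t - a) (fun t => expmx (t *: B) i j)).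
  by apply: cvgB; [exact: cvg_id|exact: cvg_cst].
exact: is_derive_continuous (is_derive_expmx B (t - a) i j).
Qed.

Lemma is_derive_expmx_shift (R : realType) m (B : 'M[R]_m) (a t : R) i j :
  is_derive t 1 (fun x => expmx ((x - a) *: B) i j)
    ((B *m expmx ((t - a) *: B)) i j).
Proof.
have H := is_derive_expmx B (t - a) i j.
have Hs : is_derive t 1 (fun x : R => x - a) 1.
  by apply: is_derive_eq; rewrite subr0.
have K := @is_derive1_comp R (fun x => expmx (x *: B) i j) (fun x => x - a) t _ _ H Hs.
by apply: (is_derive_eq K); rewrite mulr1.
Qed.

Lemma is_derive_expmx_opp (R : realType) m (B : 'M[R]_m) (a t : R) i j :
  is_derive t 1 (fun x => expmx ((a - x) *: B) i j)
    (- (B *m expmx ((a - t) *: B)) i j).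
Proof.
have H := is_derive_expmx B (a - t) i j.
have Hs : is_derive t 1 (fun x : R => a - x) (- 1).
  by apply: is_derive_eq; ring.
have K := @is_derive1_comp R (fun x => expmx (x *: B) i j) (fun x => a - x) t _ _ H Hs.
by apply: (is_derive_eq K); rewrite mulrN1.
Qed.

(** As B commutes with its exponential, e^(sB) e^(-sB) v has zero derivative in s, hence keeps its
    value [v] at 0. *)
Lemma expmx_mulNmx (R : realType) m (B : 'M[R]_m) (t : R) (v : 'cV[R]_m) :
  expmx (t *: B) *m (expmx (- t *: B) *m v) = v.
Proof.
pose h s := expmx (s *: B) *m (expmx (- s *: B) *m v).
have E0 : expmx ((0 : R) *: B) = 1%:M by rewrite scale0r expmx0.
have h0 : h 0 = v by rewrite /h oppr0 E0 !mul1mx.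
rewrite -[LHS]/(h t) -[RHS]h0.
have dN (s : R) i j : is_derive s 1 (fun x => expmx (- x *: B) i j)
    ((- (B *m expmx (- s *: B))) i j).
  rewrite [X in is_derive _ _ _ X]mxE; have := is_derive_expmx_opp B 0 s i j.
  by rewrite sub0r; under eq_fun do rewrite sub0r.
have dh (s : R) : is_derive s 1 h 0.
  have dv : is_derive s 1 (fun x => expmx (- x *: B) *m v)
      (- (B *m expmx (- s *: B)) *m v).
    have := is_derive_mulmx (M := fun x => expmx (- x *: B))
      (dM := fun x => - (B *m expmx (- x *: B))) (dN s) (is_derive_cst v s 1).
    by rewrite mulmx0 addr0.
  have := is_derive_mulmx (M := fun x => expmx (x *: B))
      (dM := fun x => B *m expmx (x *: B)) (is_derive_expmx B s) dv.
  by move=> /is_derive_eq; apply; rewrite -expmx_comm mulNmx mulmxN !mulmxA subrr.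
apply/matrixP => i j; rewrite ord1.
apply: (@is_derive_0_is_cst _ (fun s => h s i 0)) => s.
by have /is_derive_cvP/(_ i) := dh s; rewrite mxE.
Qed.

(** * Inhomogeneous linear equations: solutions and estimates *)

Lemma primitive_ex (R : realType) (g : R -> R) (a : R) : continuous g ->
  exists G : R -> R, G a = 0 /\ forall t, a - 1 < t -> is_derive t 1 G (g t).
Proof.
move=> cg.
pose mu := @lebesgue_measure R.
(* Integrating from [a - 1] makes [a] an interior point, so that the derivative at [a] is
   two-sided. *)
pose G t := (\int[mu]_(s in `[a - 1, t]) g s)%R.
exists (fun t => G t - G a); split; first by rewrite subrr.
move=> t at1.
have [] := @continuous_FTC1 R g (BLeft (a - 1)) t (t + 1) _ _ _ _.
- by rewrite ltrDl.
- apply: continuous_compact_integrable; first exact: segment_compact.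
  exact: continuous_subspaceT.
- by rewrite lte_fin.
- exact: cg.
rewrite -/mu => dG GE.
have DG : is_derive t 1 G (g t) by split=> //; rewrite -derive1E.
apply: is_derive_eq; exact: subr0.
Qed.

(** Variation of constants: [C t] is e^((t - t0)B) applied to [x0] plus the integral of e^((t0 -
    s)B) g(s) from [t0] to [t]. *)
Lemma linear_ivp (R : realType) m (B : 'M[R]_m) (g : R -> 'cV[R]_m) (t0 : R)
    (x0 : 'cV[R]_m) : continuous g ->
  exists C : R -> 'cV[R]_m, C t0 = x0 /\
    forall t, t0 - 1 < t -> is_derive t 1 C (B *m C t + g t).
Proof.
move=> cg.
pose f s := expmx ((t0 - s) *: B) *m g s.
have cf : continuous f.
  apply: continuous_mulmx => // i j t.
  exact: is_derive_continuous (is_derive_expmx_opp B t0 t i j).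
have pf i := primitive_ex t0 (fun x => (cv_continuousP _).1 cf i x).
pose c (t : R) : 'cV[R]_m := \col_i sval (cid (pf i)) t.
have c0 : c t0 = 0.
  by apply/matrixP => i j; rewrite !mxE; have [] := svalP (cid (pf i)).
have dc t : t0 - 1 < t -> is_derive t 1 c (f t).
  move=> tt0; apply/is_derive_cvP => i; under eq_fun do rewrite mxE.
  by have [_] := svalP (cid (pf i)); apply.
exists (fun t => expmx ((t - t0) *: B) *m (x0 + c t)); split.
  by rewrite subrr scale0r expmx0 mul1mx c0 addr0.
move=> t tt0.
have dxc : is_derive t 1 (fun t => x0 + c t) (f t).
  have := dc _ tt0 => dct.
  have := is_deriveD (is_derive_cst x0 t 1) dct.
  by move=> /is_derive_eq; apply; rewrite add0r.
have := is_derive_mulmx (M := fun x => expmx ((x - t0) *: B))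
    (dM := fun x => B *m expmx ((x - t0) *: B)) (is_derive_expmx_shift B t0 t) dxc.
move=> /is_derive_eq; apply; rewrite mulmxA; congr (_ + _).
by rewrite /f -[t0 - t]opprB expmx_mulNmx.
Qed.

(** [y] may have a corner at [t0], so the derivative at [t0] itself is stated for [C] only; it later
    yields the one-sided derivative of the solution at time 0. *)
Lemma linear_ivp_glue (R : realType) m (B : 'M[R]_m) (g : R -> 'cV[R]_m) (t0 : R)
    (x0 : R -> 'cV[R]_m) : continuous g -> continuous x0 ->
  exists y C : R -> 'cV[R]_m, [/\ continuous y, forall t, t <= t0 -> y t = x0 t,
    forall t, t0 <= t -> y t = C t,
    forall t, t0 <= t -> is_derive t 1 C (B *m C t + g t) &
    forall t, t0 < t -> is_derive t 1 y (B *m y t + g t)].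
Proof.
move=> cg cx0; have [C [C0 dC]] := linear_ivp B t0 (x0 t0) cg.
pose y t := if t <= t0 then x0 t else C t.
have yl t : t <= t0 -> y t = x0 t by rewrite /y => ->.
have yr t : t0 <= t -> y t = C t.
  rewrite /y le_eqVlt => /predU1P[<-|]; first by rewrite lexx.
  by rewrite ltNge => /negbTE ->.
have {}dC t : t0 <= t -> is_derive t 1 C (B *m C t + g t).
  by move=> t0t; apply: dC; rewrite (lt_le_trans _ t0t)// gtrDl ltrN10.
have dy t : t0 < t -> is_derive t 1 y (B *m y t + g t).
  move=> t0t; rewrite yr ?ltW//.
  apply: (@near_eq_is_derive _ _ _ C); rewrite ?oner_eq0//; last by apply: dC; exact: ltW.
  by near=> s; rewrite yr// ltW//; near: s; exact: lt_nbhsr.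
exists y, C; split=> // t.
have [tt0|t0t|->] := ltgtP t t0.
- rewrite /continuous_at yl ?ltW//; apply: cvg_trans (cx0 t); apply: near_eq_cvg.
  by near=> s; rewrite yl// ltW//; near: s; exact: lt_nbhsl.
- exact: is_derive_continuous (dy _ t0t).
apply/cvgrPdist_lt => e e0; rewrite yl//.
have /cvgrPdist_lt/(_ _ e0) n1 := cx0 t0.
have := is_derive_continuous (dC _ (lexx t0)) => /cvgrPdist_lt/(_ _ e0); rewrite C0 => n2.
near=> s; have [st0|/ltW st0] := leP s t0.
  by rewrite yl//; near: s.
by rewrite yr//; near: s.
Unshelve. all: by end_near. Qed.

(** A bound for the operator norm of [B] in the max norm; it is the rate [b] of the exponential
    estimates below. *)
Definition mx_abs_sum (R : realType) m (B : 'M[R]_m) : R := \sum_i \sum_j `|B i j|.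

Lemma mx_abs_sum_ge0 (R : realType) m (B : 'M[R]_m) : 0 <= mx_abs_sum B.
Proof. by do 2 apply: sumr_ge0 => ? _. Qed.

Lemma mx_abs_sum_row (R : realType) m (B : 'M[R]_m) i :
  \sum_j `|B i j| <= mx_abs_sum B.
Proof. by rewrite [leRHS](bigD1 i)//= lerDl sumr_ge0// => k _; exact: sumr_ge0. Qed.

Lemma mulmx_cv_bound (R : realType) m (B : 'M[R]_m) (v : 'cV[R]_m) e i :
  (forall j, `|v j 0| <= e) -> `|(B *m v) i 0| <= mx_abs_sum B * e.
Proof.
move=> ve; have e0 : 0 <= e by exact: le_trans (ve i).
rewrite mxE (le_trans (ler_norm_sum _ _ _))//.
apply: (@le_trans _ _ (\sum_j `|B i j| * e)).
  by apply: ler_sum => j _; rewrite normrM ler_wpM2l.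
by rewrite -mulr_suml ler_wpM2r// mx_abs_sum_row.
Qed.

Lemma linear_upper_bound (R : realType) m (B : 'M[R]_m) (s T k : R)
    (q g : R -> 'cV[R]_m) :
  quasipositive B -> continuous q ->
  (forall t, s < t <= T -> is_derive t 1 q (B *m q t + g t)) ->
  0 <= k -> (forall t, s < t <= T -> forall i, g t i 0 <= k) -> cv_le (q s) 0 ->
  forall t, s <= t <= T -> forall i,
    q t i 0 <= k * (t - s) * expR (mx_abs_sum B * (t - s)).
Proof.
move=> qB cq Dq k0 gk qs t tI i; set b := mx_abs_sum B.
(* [z] vanishes at [s] and z' = b z + k e^(b(t - s)) >= b z + k, so the vector with all components
   [z] dominates [q]. *)
pose z t := k * (t - s) * expR (b * (t - s)).
pose w t : 'cV[R]_m := const_mx (z t) - q t.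
have Dz (u : R) : is_derive u 1 z (b * z u + k * expR (b * (u - s))).
  have D1 : is_derive u 1 (fun u => u - s) 1 by apply: is_derive_eq; rewrite subr0.
  have D2 : is_derive u 1 (fun u => k * (u - s)) k.
    by apply: is_derive_eq; rewrite /GRing.scale/= mulr1.
  have D3 : is_derive u 1 (fun u => b * (u - s)) b.
    by apply: is_derive_eq; rewrite /GRing.scale/= mulr1.
  have D4 := @is_derive1_comp R expR (fun u => b * (u - s)) u _ _
    (is_derive_expR _) D3.
  have D5 := is_deriveM D2 D4.
  by apply: (is_derive_eq D5); rewrite /z /GRing.scale/=; ring.
have cz : continuous z by move=> u; exact: is_derive_continuous (Dz u).
suff /(_ i) : cv_le 0 (w t) by rewrite !mxE subr_ge0.
apply: (@linear_comparison _ _ B s T w (fun t =>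
  const_mx (b * z t + k * expR (b * (t - s))) - (B *m q t + g t))) => //.
- move=> u; apply: cvgB; last exact: cq.
  by apply/cv_cvgP => j; rewrite mxE; under eq_fun do rewrite mxE; exact: cz.
- move=> u uI; apply: is_deriveB; last exact: Dq.
  by apply/is_derive_cvP => j; rewrite mxE; under eq_fun do rewrite mxE; exact: Dz.
- move=> u uI j; rewrite mulmxBr opprD addrA !mxE.
  have su : 0 <= u - s by case/andP: uI => /ltW; rewrite subr_ge0.
  have z0 : 0 <= z u by rewrite /z !mulr_ge0 ?expR_ge0.
  have le1 : \sum_l B j l * (const_mx (z u) : 'cV[R]_m) l 0 <= b * z u.
    under eq_bigr do rewrite mxE.
    rewrite -mulr_suml ler_wpM2r// (le_trans _ (mx_abs_sum_row B j))//.
    by apply: ler_sum => l _; exact: ler_norm.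
  have le2 : g u j 0 <= k * expR (b * (u - s)).
    apply: le_trans (gk u uI j) _; rewrite ler_peMr// -expR0 ler_expR.
    by rewrite mulr_ge0// mx_abs_sum_ge0.
  by rewrite addrAC lerD2r -addrA -[leLHS]addr0 lerD// subr_ge0.
- move=> j; rewrite !mxE /z subrr mulr0 mul0r sub0r oppr_ge0.
  by have := qs j; rewrite mxE.
Qed.

Lemma linear_bound (R : realType) m (B : 'M[R]_m) (s T k : R)
    (q g : R -> 'cV[R]_m) :
  quasipositive B -> continuous q ->
  (forall t, s < t <= T -> is_derive t 1 q (B *m q t + g t)) ->
  0 <= k -> (forall t, s < t <= T -> forall i, `|g t i 0| <= k) -> q s = 0 ->
  forall t, s <= t <= T -> forall i,
    `|q t i 0| <= k * (t - s) * expR (mx_abs_sum B * (t - s)).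
Proof.
move=> qB cq Dq k0 gk qs t tI i; rewrite ler_norml; apply/andP; split; last first.
  apply: (linear_upper_bound qB cq Dq k0 _ _ tI) => [u uI j|j]; last by rewrite qs.
  by have := gk u uI j; rewrite ler_norml => /andP[].
rewrite lerNl; have -> : - q t i 0 = (fun x => - q x) t i 0 by rewrite mxE.
apply: (@linear_upper_bound _ _ B s T k (fun x => - q x) (fun x => - g x)) => //.
- by move=> u; apply: cvgN; exact: cq.
- move=> u uI; have DD := Dq u uI.
  by apply: (is_derive_eq (is_deriveN DD)); rewrite opprD mulmxN.
- move=> u uI j; rewrite mxE; have := gk u uI j; rewrite ler_norml => /andP[+ _].
  by rewrite lerNl.
- by move=> j; rewrite qs oppr0.
Qed.

(** * Segments and the exponential cone *)

Section Segments.
Context (R : realType) (r : R) (m : nat).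
Implicit Types (y d : R -> 'cV[R]_m) (phi psi : history r m).

Lemma delay_itvP (s : delay_itv r) : - r <= \val s <= 0.
Proof. by have := valP s; rewrite inE /= in_itv. Qed.

Lemma delay_itv_mem (s : R) : - r <= s <= 0 -> s \in (`[- r, 0]%classic : set R).
Proof. by move=> sr; rewrite inE /= in_itv. Qed.

Definition delay_pt (s : R) (hs : - r <= s <= 0) : delay_itv r :=
  exist _ s (delay_itv_mem hs).

Lemma delay_val_continuous : continuous (fun s : delay_itv r => \val s).
Proof. exact: initial_continuous. Qed.

Lemma history_ext phi psi : (forall s, phi s = psi s) -> phi = psi.
Proof. by move=> H; apply: val_inj; apply/funext. Qed.

Lemma historyDE phi psi s : (phi + psi) s = phi s + psi s.
Proof. by []. Qed.

Lemma historyBE phi psi s : (phi - psi) s = phi s - psi s.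
Proof. by []. Qed.

Lemma historyZE (l : R) phi s : (l *: phi) s = l *: phi s.
Proof. by []. Qed.

Lemma continuous_shift y t : continuous y -> continuous (fun s => y (t + s)).
Proof.
move=> cy s; apply: (@continuous_comp _ _ _ (fun s : R => t + s) y); last exact: cy.
by apply: cvgD; [exact: cvg_cst|exact: cvg_id].
Qed.

Lemma segmentE y t s : continuous y -> segment r y t s = y (t + \val s).
Proof.
move=> cy; rewrite /segment -[_ s]/(\val (insubd (0 : history r m) (fun s => y (t + \val s))) s).
rewrite insubdK//; apply/cts_historyP => u.
apply: (@continuous_comp _ _ _ (fun s : delay_itv r => \val s) (fun s => y (t + s))).
  exact: delay_val_continuous.
exact: continuous_shift.
Qed.

Lemma segmentB y d t : continuous y -> continuous d ->
  segment r (fun t => y t - d t) t = segment r y t - segment r d t.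
Proof.
move=> cy cd; apply: history_ext => s.
rewrite segmentE; last by move=> u; apply: cvgB; [exact: cy|exact: cd].
by rewrite historyBE !segmentE.
Qed.

Lemma segmentD y d t : continuous y -> continuous d ->
  segment r (fun t => y t + d t) t = segment r y t + segment r d t.
Proof.
move=> cy cd; apply: history_ext => s.
rewrite segmentE; last by move=> u; apply: cvgD; [exact: cy|exact: cd].
by rewrite historyDE !segmentE.
Qed.

Lemma segmentZ (l : R) y t : continuous y ->
  segment r (fun t => l *: y t) t = l *: segment r y t.
Proof.
move=> cy; apply: history_ext => s.
rewrite segmentE; last by move=> u; apply: cvgZl_tmp; exact: cy.
by rewrite historyZE !segmentE.
Qed.

(** Continuity of [y] gives closeness for times near [t0] and delays near a given one; compactness
    of the delay interval yields one neighborhood of [t0] for all delays. *)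
Lemma segment_continuous y : continuous y -> continuous (segment r y).
Proof.
move=> cy t0; apply/cvgrPdist_le => e e0.
have /compact_near_coveringP K : compact (`[- r, 0]%classic : set R) by exact: segment_compact.
have : \forall t \near t0,
    `[- r, 0]%classic `<=` (fun s => `|y (t0 + s) - y (t + s)| <= e).
  apply: (K R (nbhs t0) (fun t s => `|y (t0 + s) - y (t + s)| <= e) _).
  move=> s0 _.
  have e20 : 0 < e / 2 by rewrite divr_gt0.
  have cD : {for (s0, t0), continuous (fun p : R * R => y (p.2 + p.1))}.
    apply: (@continuous_comp _ _ _ (fun p : R * R => p.2 + p.1) y); last exact: cy.
    by apply: cvgD; [exact: cvg_snd|exact: cvg_fst].
  have c1 := @continuous_shift y t0 cy s0.
  move/cvgrPdist_le: cD => /(_ _ e20) cD; move/cvgrPdist_le: c1 => /(_ _ e20) c1.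
  have {}c1 : \forall p \near (s0, t0), `|y (t0 + s0) - y (t0 + p.1)| <= e / 2.
    exact: (cvg_fst c1).
  near=> p => /=.
  have -> : y (t0 + p.1) - y (p.2 + p.1) =
     - (y (t0 + s0) - y (t0 + p.1)) + (y (t0 + s0) - y (p.2 + p.1)).
    by rewrite opprB addrA subrK.
  rewrite (le_trans (ler_normD _ _))// normrN (splitr e) lerD//.
    by near: p.
  by near: p.
apply: filterS => t nK; apply: history_norm_le => [|s]; first exact: ltW.
rewrite historyBE !segmentE//.
by apply: nK; rewrite /= in_itv /= delay_itvP.
Unshelve. all: by end_near. Qed.

End Segments.

Section Cone.
Context (R : realType) (r : R) (m : nat) (B : 'M[R]_m).
Implicit Types (y d : R -> 'cV[R]_m) (phi psi : history r m).

Lemma segment_norm_le y t e : continuous y -> 0 <= e ->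
  (forall s, t - r <= s <= t -> forall i, `|y s i 0| <= e) -> `|segment r y t| <= e.
Proof.
move=> cy e0 ye; apply: history_norm_le => // s; rewrite segmentE//.
apply: cv_norm_le => // i; apply: ye.
by have /andP[? ?] := delay_itvP s; rewrite lerD2l gerDl; apply/andP.
Qed.

Lemma segment_delay0 (hr : 0 < r) y t : continuous y ->
  segment r y t (delay0 hr) = y t.
Proof. by move=> cy; rewrite segmentE//= addr0. Qed.

Lemma le_segment_norm (hr : 0 < r) y t i : continuous y ->
  `|y t i 0| <= `|segment r y t|.
Proof.
move=> cy; rewrite -(segment_delay0 hr t cy).
exact: le_trans (mx_entry_le _ _ _) (history_norm_ub _ _).
Qed.

Lemma exp_cone_segmentP y t : continuous y ->
  exp_cone B (segment r y t) <->
  (forall s, t - r <= s <= t -> cv_le 0 (y s)) /\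
  (forall s u, t - r <= s -> s <= u -> u <= t ->
     cv_le (expmx ((u - s) *: B) *m y s) (y u)).
Proof.
move=> cy; split=> [[pos mono]|[pos mono]]; last first.
  split=> [s|s u su].
    rewrite segmentE//; apply: pos.
    by have /andP[? ?] := delay_itvP s; rewrite lerD2l gerDl; apply/andP.
  rewrite !segmentE//; have -> : \val u - \val s = (t + \val u) - (t + \val s) by ring.
  have /andP[? _] := delay_itvP s; have /andP[_ ?] := delay_itvP u.
  by apply: mono; rewrite ?lerD2l ?gerDl.
have dp s : t - r <= s -> s <= t -> - r <= s - t <= 0.
  by move=> ? ?; rewrite lerBrDl subr_le0; apply/andP.
split=> [s /andP[s1 s2]|s u s1 su s2].
  by have := pos (delay_pt (dp _ s1 s2)); rewrite segmentE//= addrC subrK.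
have := mono (delay_pt (dp _ s1 (le_trans su s2))) (delay_pt (dp _ (le_trans s1 su) s2)).
rewrite !segmentE//= ![t + _]addrC !subrK lerD2r => /(_ su).
by have -> : u - t - (s - t) = u - s by ring.
Qed.

Lemma exp_cone0 : exp_cone B (0 : history r m).
Proof.
split=> [s i|s u _ i]; first exact: lexx.
rewrite -[(0 : history r m) s]/(0 : 'cV[R]_m) -[(0 : history r m) u]/(0 : 'cV[R]_m).
by rewrite mulmx0.
Qed.

Lemma exp_coneD phi psi : exp_cone B phi -> exp_cone B psi -> exp_cone B (phi + psi).
Proof.
move=> [p1 p2] [q1 q2]; split=> [s i|s u su i].
  by have := p1 s i; have := q1 s i; rewrite !mxE => ? ?; rewrite addr_ge0.
rewrite !historyDE.
by rewrite mulmxDr !mxE; apply: lerD; [have := p2 _ _ su i|have := q2 _ _ su i]; rewrite !mxE.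
Qed.

(** Nonnegativity is [linear_comparison]. For the growth condition between [s] and [u], d(x) - e^((x
    - s)B) d(s) satisfies the same differential inequality as [d]. *)
Lemma exp_cone_propagation d (dd : R -> 'cV[R]_m) (t0 T : R) :
  quasipositive B -> continuous d ->
  exp_cone B (segment r d t0) ->
  (forall t, t0 < t <= T -> is_derive t 1 d (dd t)) ->
  (forall t, t0 < t <= T -> cv_le (B *m d t) (dd t)) ->
  forall t, t0 <= t <= T -> exp_cone B (segment r d t).
Proof.
move=> qB cd /exp_cone_segmentP-/(_ cd)[pos mono] Dd ddB t /andP[t0t tT].
(* For negative [r] the window [t - r, t] is empty and both conditions hold vacuously. *)
have [rneg|r0] := ltP r 0.
  apply/exp_cone_segmentP => //; split=> [s|s u s1 su s2].
    move=> /andP[s1 s2]; exfalso; have := le_trans s1 s2; lra.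
  exfalso; have := le_trans s1 (le_trans su s2); lra.
have dpos s : t0 <= s <= T -> cv_le 0 (d s).
  apply: (linear_comparison qB cd Dd ddB); apply: pos.
  by rewrite lexx gerBl r0.
apply/exp_cone_segmentP => //; split=> [s /andP[s1 s2]|s u s1 su s2].
  have [st0|t0s] := leP s t0; first by apply: pos; rewrite st0 andbT; lra.
  by apply: dpos; rewrite ltW//= (le_trans s2).
have [ut0|t0u] := leP u t0; first by apply: mono => //; lra.
(* The differential inequality holds only after [t0]. At [a] the function [w] is nonnegative by the
   initial segment if [s <= t0], and zero otherwise. *)
pose a := Num.max s t0.
pose w x := d x - expmx ((x - s) *: B) *m d s.
have ceE : continuous (fun x => expmx ((x - s) *: B) *m d s).
  by apply: continuous_mulmx; [exact: continuous_expmx|exact: cst_continuous].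
suff wu : cv_le 0 (w u).
  by move=> i; have := wu i; rewrite mxE [leRHS]mxE [X in _ + X]mxE subr_ge0.
have sa x : a < x <= T -> t0 < x <= T by rewrite gt_max => /andP[/andP[_ ->] ->].
apply: (@linear_comparison _ _ B a T w
  (fun x => dd x - B *m (expmx ((x - s) *: B) *m d s))) => //.
- by move=> x; apply: cvgB; [exact: cd|exact: ceE].
- move=> x /sa xI; apply: is_deriveB; first exact: Dd.
  have := is_derive_mulmx (M := fun x => expmx ((x - s) *: B))
    (dM := fun x => B *m expmx ((x - s) *: B)) (is_derive_expmx_shift B s x)
    (is_derive_cst (d s) x 1).
  by rewrite mulmx0 addr0 mulmxA.
- move=> x /sa xI i; rewrite mulmxBr mxE [leRHS]mxE lerD2r; exact: ddB.
- move=> i; rewrite mxE [leRHS]mxE [X in _ + X]mxE subr_ge0 /a.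
  have [st0|t0s] := leP s t0; first by apply: mono => //; lra.
  by rewrite subrr scale0r expmx0 mul1mx.
- by rewrite ge_max su (ltW t0u) (le_trans s2).
Qed.

End Cone.

(** * Comparison of sub-solutions with solutions *)

(** The scalar mean value theorem gives a different intermediate point for each component; under the
    max norm this does not worsen the constant. *)
Lemma mean_value_le (R : realType) (V : normedModType R) m (f : V -> 'cV[R]_m)
    (x v : V) (L : R) : 0 <= L ->
  (forall t : R, 0 <= t <= 1 -> differentiable f (x + t *: v)) ->
  (forall t : R, 0 <= t <= 1 -> `|'d f (x + t *: v) v| <= L) ->
  `|f (x + v) - f x| <= L.
Proof.
move=> L0 df dfL; apply: cv_norm_le => // i.
pose g (t : R) := f (x + t *: v).
have Dg (t : R) : 0 <= t <= 1 -> is_derive t 1 g ('d f (x + t *: v) v).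
  move=> tI; have dv := diff_derivable (v := v) (df _ tI).
  have E : (fun h => h^-1 *: ((g \o shift t) (h *: 1) - g t)) =
      (fun h => h^-1 *: ((f \o shift (x + t *: v)) (h *: v) - f (x + t *: v))).
    apply/funext => h; congr (_ *: (_ - _)); rewrite /g /=; congr f.
    by rewrite [h *: 1]mulr1 scalerDl addrCA.
  split; first by rewrite /derivable E.
  by rewrite /derive E -/(derive f (x + t *: v) v) deriveE//; exact: df.
have Dgi (t : R) : 0 <= t <= 1 ->
    is_derive t 1 (fun t => g t i 0) ('d f (x + t *: v) v i 0).
  by move=> /Dg /is_derive_cvP.
have [||c cI] := @MVT R (fun t => g t i 0) (fun t => 'd f (x + t *: v) v i 0) 0 1 ltr01.
- by move=> t /[!in_itv]/= /andP[/ltW t0 /ltW t1]; apply: Dgi; rewrite t0.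
- by apply: derivable_within_continuous => t; rewrite in_itv /= => /Dgi[].
rewrite subr0 mulr1 /g scale1r scale0r addr0 !mxE => ->.
apply: le_trans (mx_entry_le _ _ _) _; apply: dfL.
by move: cI; rewrite in_itv /= => /andP[/ltW -> /ltW ->].
Qed.

Lemma convex_lt (R : realFieldType) (t p q d : R) : 0 <= t -> t <= 1 ->
  p < d -> q < d -> (1 - t) * p + t * q < d.
Proof.
move=> t0 t1 pd qd; have [->|tneq] := eqVneq t 0; first by rewrite subr0 mul1r mul0r addr0.
have tpos : 0 < t by rewrite lt_neqAle eq_sym tneq.
have : t * q < t * d by rewrite ltr_pM2l.
have : (1 - t) * p <= (1 - t) * d by rewrite ler_wpM2l ?subr_ge0// ltW.
lra.
Qed.

Lemma convex_ball (R : realType) (V : normedModType R) (x0 x y : V) (t d : R) :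
  0 <= t <= 1 -> `|x - x0| < d -> `|y - x0| < d -> `|x + t *: (y - x) - x0| < d.
Proof.
move=> /andP[t0 t1] xd yd.
have -> : x + t *: (y - x) - x0 = (1 - t) *: (x - x0) + t *: (y - x0).
  have -> : y - x0 = (y - x) + (x - x0) by rewrite addrA subrK.
  rewrite [t *: (y - x + _)]scalerDr scalerBl scale1r.
  by rewrite [t *: (y - x) + _]addrC addrA subrK addrAC.
rewrite (le_lt_trans (ler_normD _ _))// !normrZ !ger0_norm ?subr_ge0//.
exact: convex_lt.
Qed.

Lemma continuous_diff_locally_lipschitz (R : realType) (Omega : topologicalType)
    (V : normedModType R) (m : nat) (F : Omega -> V -> 'cV[R]_m) (w0 : Omega)
    (x0 : V) :
  (forall w x, differentiable (F w) x) ->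
  (\forall w \near w0 & x \near x0,
     forall h, `|'d (F w) x h - 'd (F w0) x0 h| <= 1 * `|h|) ->
  exists L d : R, [/\ 0 <= L, 0 < d & \forall w \near w0, forall x y,
    `|x - x0| < d -> `|y - x0| < d -> `|F w y - F w x| <= L * `|y - x|].
Proof.
move=> dF cF.
have [M M0 dM] : exists2 M : R, 0 <= M & forall h, `|'d (F w0) x0 h| <= M * `|h|.
  have cd : continuous ('d (F w0) x0) := diff_continuous (dF w0 x0).
  have /linear_boundedP H := (linear_bounded_continuous _).2 cd.
  have : \forall M \near +oo, 0 <= M /\ forall h, `|'d (F w0) x0 h| <= M * `|h|.
    near=> M; split; last by near: M.
    by near: M; exact: nbhs_pinfty_ge.
  by move=> /filter_ex[M []]; exists M.
have [[U W] /= [Uw0 Wx0] UW] := cF.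
have /nbhs_ballP[d /= d0 dW] := Wx0.
(* [M] bounds the differential at [(w0, x0)] and 1 bounds its variation over [U] and [W]; as balls
   are convex, the segment from [x] to [y] stays in [W]. *)
exists (M + 1), d; split=> //; first by rewrite addr_ge0.
apply: filterS Uw0 => w Uw x y xd yd.
have -> : F w y = F w (x + (y - x)) by rewrite addrC subrK.
apply: mean_value_le => [|t _|t tI]; first by rewrite mulr_ge0// addr_ge0.
  exact: dF.
have Wt : W (x + t *: (y - x)).
  by apply: dW; rewrite -ball_normE /ball_ /= distrC; exact: convex_ball.
have := UW (w, x + t *: (y - x)) (conj Uw Wt) (y - x); rewrite /= mul1r => H.
rewrite -[X in `|X|](subrK ('d (F w0) x0 (y - x))) (le_trans (ler_normD _ _))//.
by rewrite mulrDl mul1r addrC lerD.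
Unshelve. all: by end_near. Qed.

(** Two curves that meet at [t0] stay for nearby times in the ball where F is Lipschitz; the curves
    will be z_t and (u + p)_t. *)
Lemma continuous_diff_lipschitz_along (R : realType) (Omega : topologicalType)
    (V : normedModType R) (m : nat) (F : Omega -> V -> 'cV[R]_m)
    (om : R -> Omega) (x y : R -> V) (t0 : R) :
  (forall w x, differentiable (F w) x) ->
  (\forall w \near om t0 & v \near x t0,
     forall h, `|'d (F w) v h - 'd (F (om t0)) (x t0) h| <= 1 * `|h|) ->
  {for t0, continuous om} -> {for t0, continuous x} -> {for t0, continuous y} ->
  x t0 = y t0 ->
  exists2 L : R, 0 <= L & \forall t \near t0,
    `|F (om t) (y t) - F (om t) (x t)| <= L * `|y t - x t|.
Proof.
move=> dF cF com cx cy xy.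
have [L [d [L0 d0 lip]]] := continuous_diff_locally_lipschitz dF cF.
exists L => //.
have n1 : \forall t \near t0, forall a b, `|a - x t0| < d -> `|b - x t0| < d ->
    `|F (om t) b - F (om t) a| <= L * `|b - a| by exact: (com _ lip).
have /cvgrPdist_lt/(_ _ d0) n2 := cx.
have /cvgrPdist_lt/(_ _ d0) := cy; rewrite -xy => n3.
near=> t; apply: (near n1 t) => //; rewrite distrC; near: t; [exact: n2|exact: n3].
Unshelve. all: by end_near. Qed.

Lemma C1_snd_lipschitz_along (R : realType) (Omega : topologicalType) (r : R)
    (m : nat) (F : Omega -> history r m -> 'cV[R]_m) (om : R -> Omega)
    (x y : R -> history r m) (t0 : R) : C1_snd F ->
  continuous om -> continuous x -> continuous y -> x t0 = y t0 ->
  exists2 L : R, 0 <= L & \forall t \near t0,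
    `|F (om t) (y t) - F (om t) (x t)| <= L * `|y t - x t|.
Proof.
move=> [dF cF] com cx cy xy; apply: continuous_diff_lipschitz_along => //.
- exact: cF.
- exact: com.
- exact: cx.
- exact: cy.
Qed.

(** Here [fu], [fv], [f] stand for a component of F at u, u + p and z, and [bp], [bd] for that of B
    p and B d. Then k >= f - fu - bd >= (fv - fu) - P - bd >= bp - bd - P >= - Q - P, which bounds
    the negative part of [k]. *)
Lemma negpart_bound (R : realFieldType) (k f fu fv a bp bd P Q : R) :
  k = f - a - bd -> a <= fu -> bp <= fv - fu -> `|bp - bd| <= Q -> `|fv - f| <= P ->
  `|Num.max k 0 - k| <= P + Q.
Proof.
move=> -> afu bpv; rewrite !ler_norml => /andP[? ?] /andP[? ?].
by have [?|?] := leP (f - a - bd) 0; apply/andP; split; lra.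
Qed.

Section Comparison.
Context (R : realType) (Omega : topologicalType) (r : R) (m : nat)
  (B : 'M[R]_m) (F : Omega -> history r m -> 'cV[R]_m) (hr : 0 < r).
Hypothesis qB : quasipositive B.
Hypothesis Fcont : continuous (fun p : Omega * history r m => F p.1 p.2).
Hypothesis FC1 : C1_snd F.
Hypothesis Fmono : forall (w : Omega) (phi psi : history r m), exp_le B phi psi ->
  cv_le (B *m (psi (delay0 hr) - phi (delay0 hr))) (F w psi - F w phi).

Lemma continuous_F_segment (om : R -> Omega) (y : R -> 'cV[R]_m) :
  continuous om -> continuous y -> continuous (fun t => F (om t) (segment r y t)).
Proof.
move=> com cy t.
apply: (@continuous_comp _ _ _ (fun t => (om t, segment r y t))
  (fun p : Omega * history r m => F p.1 p.2)); last exact: Fcont.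
have h1 : om s @[s --> t] --> om t by exact: com.
have h2 : segment r y s @[s --> t] --> segment r y t by exact: segment_continuous.
exact: cvg_pair h1 h2.
Qed.

Context (om : R -> Omega) (u z a : R -> 'cV[R]_m).
Hypothesis com : continuous om.
Hypothesis cu : continuous u.
Hypothesis cz : continuous z.
Hypothesis ca : continuous a.
Hypothesis Du : forall t : R, 0 < t -> is_derive t 1 u (a t).
Hypothesis Dz : forall t : R, 0 < t -> is_derive t 1 z (F (om t) (segment r z t)).
Hypothesis aF : forall t : R, 0 <= t -> cv_le (a t) (F (om t) (segment r u t)).

Let d t := z t - u t.
(** The defect d' - B d: its nonnegativity is what [exp_cone_propagation] asks of [d]. *)
Let k t := F (om t) (segment r z t) - a t - B *m d t.

Let cd : continuous d.
Proof. by move=> t; apply: cvgB; [exact: cz|exact: cu]. Qed.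

Let ck : continuous k.
Proof.
move=> t; apply: cvgB; first by apply: cvgB; [exact: continuous_F_segment|exact: ca].
by apply: continuous_mulmx => [i j|]; [exact: cst_continuous|exact: cd].
Qed.

Let Dd (t : R) : 0 < t -> is_derive t 1 d (F (om t) (segment r z t) - a t).
Proof. by move=> t0; apply: is_deriveB; [exact: Dz|exact: Du]. Qed.

(* [p] solves [p' = B p + k^+], so it stays in the cone, while [d' = B d + k].
   The defect [q = p - d] solves [q' = B q + k^-], and monotonicity at [u + p]
   together with the Lipschitz bound gives [k^- <= C |q_t|]: over a short time
   this forces [k^- = 0]. *)
Let comparison_local t0 : 0 <= t0 -> exp_cone B (segment r d t0) ->
  exists2 e, 0 < e & forall t, t0 <= t <= t0 + e -> cv_le 0 (k t).
Proof.
move=> t00 d0.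
pose kp t : 'cV[R]_m := \col_i Num.max (k t i 0) 0.
pose km t : 'cV[R]_m := kp t - k t.
have ckp : continuous kp.
  apply/cv_continuousP => i t; rewrite /continuous_at mxE; under eq_fun do rewrite mxE.
  apply: continuous_max; last exact: (@cst_continuous _ _ (0 : R)).
  by have /cv_continuousP := ck; apply.
have ckm : continuous km by move=> t; apply: cvgB; [exact: ckp|exact: ck].
have [p [_ [cp pd _ _ Dp]]] := linear_ivp_glue B t0 ckp cd.
pose q t := p t - d t.
have cq : continuous q by move=> t; apply: cvgB; [exact: cp|exact: cd].
have q0 t : t <= t0 -> q t = 0 by move=> tt0; rewrite /q pd// subrr.
have Dq (t : R) : t0 < t -> is_derive t 1 q (B *m q t + km t).
  move=> t0t; have D1 := Dp _ t0t; have D2 := Dd (le_lt_trans t00 t0t).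
  apply: (is_derive_eq (is_deriveB D1 D2)).
  rewrite /km /q mulmxBr /k; generalize (kp t) => kpt.
  by apply/matrixP => i j; rewrite !mxE; ring.
have conep t : t0 <= t -> exp_cone B (segment r p t).
  move=> t0t; apply: (@exp_cone_propagation _ _ _ B p (fun t => B *m p t + kp t) t0 t) => //.
  - have -> : segment r p t0 = segment r d t0; last by [].
    apply: history_ext => s; rewrite !segmentE// pd//.
    by have /andP[_ ?] := delay_itvP s; rewrite gerDl.
  - by move=> s /andP[/Dp].
  - by move=> s _ i; rewrite [leRHS]mxE lerDl !mxE le_max lexx orbT.
  - by rewrite t0t lexx.
have cup : continuous (fun t => u t + p t) by move=> t; apply: cvgD; [exact: cu|exact: cp].
(* Up to [t0], p equals d and u + p equals z: the two segments meet at [t0], as the Lipschitz bound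
   requires. *)
have upE : segment r z t0 = segment r (fun t => u t + p t) t0.
  apply: history_ext => s; rewrite !segmentE// pd; first by rewrite /d [RHS]addrC subrK.
  by have /andP[_ ?] := delay_itvP s; rewrite gerDl.
have [L L0 lipt] := C1_snd_lipschitz_along FC1 com (segment_continuous cz)
  (segment_continuous cup) upE.
have qE t : segment r (fun t => u t + p t) t - segment r z t = segment r q t.
  have <- : (fun t => u t + p t - z t) = q.
    by apply/funext => s; rewrite /q /d opprB addrA [p s + _]addrC.
  exact: esym (@segmentB R r m (fun t => u t + p t) z t cup cz).
have kmt : \forall t \near t0, t0 <= t -> forall i,
    `|km t i 0| <= (L + mx_abs_sum B) * `|segment r q t|.
  near=> t => t0t i.
  have t00' : 0 <= t := le_trans t00 t0t.
  set Q := `|segment r q t|.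
  have h1 : `|F (om t) (segment r (fun t => u t + p t) t) - F (om t) (segment r z t)| <= L * Q.
    by rewrite /Q -qE; near: t.
  have h2 := aF t00' i.
  have h3 : (B *m p t) i 0 <= (F (om t) (segment r (fun t => u t + p t) t) -
      F (om t) (segment r u t)) i 0.
    have := @Fmono (om t) (segment r u t) (segment r (fun t => u t + p t) t) _ i.
    rewrite !segment_delay0// [u t + _]addrC addrK; apply.
    by rewrite /exp_le segmentD// addrAC subrr add0r; exact: conep.
  have h4 : `|(B *m q t) i 0| <= mx_abs_sum B * Q.
    by apply: mulmx_cv_bound => j; exact: le_segment_norm.
  have h5 : `|F (om t) (segment r (fun t => u t + p t) t) i 0 -
      F (om t) (segment r z t) i 0| <= L * Q.
    apply: le_trans h1; have := mx_entry_le (F (om t) (segment r (fun t => u t + p t) t) -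
      F (om t) (segment r z t)) i 0.
    by rewrite cv_subE.
  have kE : k t i 0 = F (om t) (segment r z t) i 0 - a t i 0 - (B *m d t) i 0.
    by rewrite /k !cv_subE.
  have kmE : km t i 0 = Num.max (k t i 0) 0 - k t i 0.
    by rewrite /km cv_subE [X in X - _]mxE.
  rewrite kmE mulrDl; apply: (negpart_bound (bp := (B *m p t) i 0) kE h2 _ _ h5).
    by rewrite -cv_subE.
  have qpd : (B *m q t) i 0 = (B *m p t) i 0 - (B *m d t) i 0.
    by rewrite /q mulmxBr cv_subE.
  by rewrite -qpd.
have [e1 /= e10 e1P] := (nbhs_ballP _ _).1 kmt.
set b := mx_abs_sum B in kmt e1P *; set C := L + b in kmt e1P *.
have b0 : 0 <= b by exact: mx_abs_sum_ge0.
have C0 : 0 <= C by rewrite addr_ge0.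
have D0 : 0 < 2 * (C + 1) * expR b by rewrite !mulr_gt0 ?expR_gt0// ltr_wpDl.
(* [e1 / 2] keeps the estimate on [km] valid, 1 bounds e^(b(s - t0)) by e^b, and the last term gives
   C e e^b <= 1/2; [C + 1] keeps its denominator positive. *)
pose e := Num.min (e1 / 2) (Num.min 1 (2 * (C + 1) * expR b)^-1).
have e_gt0 : 0 < e by rewrite !lt_min divr_gt0//= ltr01 invr_gt0.
have ee1 : e < e1.
  by rewrite (@le_lt_trans _ _ (e1 / 2)) ?ge_min ?lexx// gtr_pMr// invf_lt1// ltr1n.
have e_le1 : e <= 1 by rewrite !ge_min lexx orbT.
have eD : C * (e * expR b) <= 1 / 2.
  have : e <= (2 * (C + 1) * expR b)^-1 by rewrite !ge_min lexx !orbT.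
  rewrite -[leRHS]mul1r ler_pdivlMr// => h.
  have := ltW (mulr_gt0 e_gt0 (expR_gt0 b)); lra.
have cn : continuous (fun t => `|km t|).
  by move=> t; apply: cvg_norm; exact: ckm.
have te : t0 <= t0 + e by rewrite lerDl ltW.
(* With [kap] the maximum of [|km|], [q] is at most kap e e^b in norm, hence [|km| <= kap / 2] on
   the whole interval, which forces [kap = 0]. *)
have [c cI cmax] := EVT_max te (continuous_subspaceT cn).
set kap := `|km c| in cmax.
have kap0 : 0 <= kap by exact: normr_ge0.
have kmk t : t0 <= t <= t0 + e -> `|km t| <= kap.
  by move=> tI; apply: cmax; rewrite in_itv.
have qbd s i : s <= t0 + e -> `|q s i 0| <= kap * (e * expR b).
  move=> st; have ke0 : 0 <= kap * (e * expR b) by rewrite !mulr_ge0 ?expR_ge0// ltW.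
  have [st0|t0s] := leP s t0; first by rewrite q0// mxE normr0.
  apply: (@le_trans _ _ (kap * (s - t0) * expR (b * (s - t0)))).
    apply: (@linear_bound _ _ B t0 (t0 + e) kap q km) => //.
    - by move=> x /andP[/Dq].
    - move=> x /andP[/ltW t0x xe] j; apply: le_trans (mx_entry_le _ _ _) _.
      by apply: kmk; rewrite t0x.
    - exact: q0.
    - by rewrite ltW.
  have ss : 0 <= s - t0 by rewrite subr_ge0 ltW.
  have se : s - t0 <= e by rewrite lerBlDl.
  rewrite -mulrA ler_wpM2l// ler_pM ?expR_ge0// ler_expR.
  by rewrite ler_piMr// (le_trans se).
have kmh t : t0 <= t <= t0 + e -> `|km t| <= kap / 2.
  move=> /andP[t0t tt].
  apply: cv_norm_le => [|i]; first by rewrite divr_ge0.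
  apply: le_trans (e1P t _ t0t i) _.
    by rewrite /ball /= ler0_norm; lra.
  have : `|segment r q t| <= kap * (e * expR b).
    apply: segment_norm_le => // [|s /andP[_ st] j].
      by rewrite !mulr_ge0 ?expR_ge0// ltW.
    by apply: qbd; exact: le_trans tt.
  move=> /(ler_wpM2l C0) /le_trans; apply.
  rewrite mulrCA ler_wpM2l//; lra.
have kapE : kap = 0.
  have := kmh c; rewrite -/kap => /(_ _)/wrap[]; first by move: cI; rewrite in_itv.
  by move=> h; apply/eqP; rewrite eq_le kap0 andbT; lra.
exists e => // t tI.
have /eqP : `|km t| = 0 by apply/eqP; rewrite eq_le normr_ge0 andbT -kapE kmk.
rewrite normr_eq0 subr_eq0 => /eqP <- i.
by rewrite !mxE le_max lexx orbT.
Unshelve. all: by end_near. Qed.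

(** Let [inf A] be the infimum of the times where [k] fails to be nonnegative. By continuity [k] is
    nonnegative up to and including a positive [inf A], so the segment there is in the cone and
    [comparison_local] pushes the failure strictly further. *)
Lemma delay_comparison : exp_cone B (segment r d 0) ->
  forall t, 0 <= t -> exp_cone B (segment r d t).
Proof.
move=> d0.
have cone T : (forall s, 0 < s <= T -> cv_le 0 (k s)) ->
    forall t, 0 <= t <= T -> exp_cone B (segment r d t).
  move=> kT; apply: (exp_cone_propagation qB cd d0 (dd := fun s => F (om s) (segment r z s) - a s)).
    by move=> s /andP[/Dd].
  by move=> s /kT k0 i; have := k0 i; rewrite mxE [leRHS]mxE [X in _ + X]mxE subr_ge0.
suff kpos t : 0 <= t -> cv_le 0 (k t).
  move=> t t0; apply: (cone t) => [s /andP[/ltW s0 _]|]; first exact: kpos.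
  by rewrite t0 lexx.
move=> t0; apply: contrapT => kneg.
pose A := [set s : R | 0 <= s /\ ~ cv_le 0 (k s)].
have A0 : A !=set0 by exists t.
have lA : has_lbound A by exists 0 => s [].
have iA0 : 0 <= inf A by apply: lb_le_inf => // s [].
have kl s : 0 <= s -> s < inf A -> cv_le 0 (k s).
  move=> s0 sA; apply: contrapT => nk.
  by have := ge_inf lA (conj s0 nk); rewrite leNgt sA.
have kl' s : 0 < s <= inf A -> cv_le 0 (k s).
  move=> /andP[s0]; rewrite le_eqVlt => /predU1P[sE|]; last by apply: kl; exact: ltW.
  move=> i; rewrite mxE leNgt; apply/negP => ks.
  have cki : continuous (fun t => k t i 0) by have /cv_continuousP := ck; apply.
  have : \forall x \near s^'-, k x i 0 < 0.
    by apply: (cvgr_lt (k s i 0)) ks; apply: cvg_at_left_filter; exact: cki.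
  have : \forall x \near s^'-, 0 < x by exact: nbhs_left_gt.
  have : \forall x \near s^'-, x < s by exact: nbhs_left_lt.
  move=> n1 n2 n3.
  have : \forall x \near s^'-, [/\ x < s, 0 < x & k x i 0 < 0] by near=> x; split; near: x.
  move=> /filter_ex[x [xs x0]]; apply/negP; rewrite -leNgt.
  by have := @kl x (ltW x0) _ i; rewrite mxE; apply; rewrite -sE.
(* If [inf A = 0], the condition on [k] is over an empty range and this is the initial
   hypothesis. *)
have cA : exp_cone B (segment r d (inf A)).
  by apply: (cone (inf A)) => //; rewrite iA0 lexx.
have [e e0 ke] := comparison_local iA0 cA.
have : inf A + e <= inf A.
  apply: lb_le_inf => // s [s0 nk]; rewrite leNgt; apply/negP => se; apply: nk.
  have [sA|As] := ltP s (inf A); first exact: kl.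
  by apply: ke; rewrite As ltW.
by rewrite gerDl leNgt e0.
Unshelve. all: by end_near. Qed.

End Comparison.

(** * Global existence in the cone *)

(** [d] is compared with [z *: e], a decaying multiple of the i-th unit vector: column i of B is
    nonnegative off the diagonal, and [B i i] is at least minus [mx_abs_sum B]. *)
Lemma decay_lower_bound (R : realType) m (B : 'M[R]_m) (s T : R)
    (d dd : R -> 'cV[R]_m) i :
  quasipositive B -> continuous d ->
  (forall t, s < t <= T -> is_derive t 1 d (dd t)) ->
  (forall t, s < t <= T -> cv_le (B *m d t) (dd t)) ->
  cv_le 0 (d s) -> forall t, s <= t <= T ->
  expR (- (mx_abs_sum B) * (t - s)) * d s i 0 <= d t i 0.
Proof.
move=> qB cd Dd ddB ds t tI; set b := mx_abs_sum B.
have ds0 : 0 <= d s i 0 by have := ds i; rewrite mxE.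
pose z t := expR (- b * (t - s)) * d s i 0.
have Dz (u : R) : is_derive u 1 z (- b * z u).
  have D1 : is_derive u 1 (fun u => u - s) 1 by apply: is_derive_eq; rewrite subr0.
  have D3 : is_derive u 1 (fun u => - b * (u - s)) (- b).
    by apply: is_derive_eq; rewrite /GRing.scale/= mulr1.
  have D4 := @is_derive1_comp R expR (fun u => - b * (u - s)) u _ _
    (is_derive_expR _) D3.
  have D5 := is_deriveM D4 (is_derive_cst (d s i 0) u 1).
  by apply: (is_derive_eq D5); rewrite /z /GRing.scale/=; ring.
have z0 u : 0 <= z u by rewrite mulr_ge0 ?expR_ge0.
pose e : 'cV[R]_m := \col_j (j == i)%:R.
pose w u := d u - z u *: e.
suff /(_ i) : cv_le 0 (w t) by rewrite !mxE eqxx mulr1 subr_ge0.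
have cz : continuous z by move=> u; exact: is_derive_continuous (Dz u).
apply: (@linear_comparison _ _ B s T w (fun u => dd u - (- b * z u) *: e)) => //.
- move=> u; apply: cvgB; first exact: cd.
  by apply: cvgZr_tmp; exact: cz.
- move=> u uI; apply: is_deriveB; first exact: Dd.
  apply/is_derive_cvP => j; under eq_fun do rewrite mxE.
  have D := Dz u; apply: is_derive_eq.
  by rewrite !mxE /GRing.scale/=; ring.
- move=> u uI j; rewrite mulmxBr !cv_subE; apply: lerB; first exact: ddB.
  rewrite -scalemxAr !mxE.
  have -> : \sum_l B j l * e l 0 = B j i.
    rewrite (bigD1 i)//= !mxE eqxx mulr1 big1 ?addr0// => l li.
    by rewrite mxE (negbTE li) mulr0.
  have [->|ji] := eqVneq j i.
    rewrite mulr1 [leRHS]mulrC ler_wpM2r// lerNl.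
    apply: le_trans (mx_abs_sum_row B i); rewrite (bigD1 i)//=.
    by rewrite ler_wpDr ?sumr_ge0// ler_normr lexx orbT.
  by rewrite mulr0 mulr_ge0// qB.
- move=> j; rewrite !mxE /z subrr mulr0 expR0 mul1r subr_ge0.
  have [->|ji] := eqVneq j i; first by rewrite mulr1.
  by rewrite mulr0; have := ds j; rewrite mxE.
Qed.

(** Continuity of [G] at each point of the curve gives a bound for times near that point and large
    [n]; compactness of [0, T] makes the rank of [n] uniform in time. *)
Lemma uniform_cvg_comp (R : realType) (Omega : topologicalType)
    (V : normedModType R) m (G : Omega -> V -> 'cV[R]_m) (om : R -> Omega)
    (x : R -> V) (xn : nat -> R -> V) (T : R) :
  continuous (fun p : Omega * V => G p.1 p.2) -> continuous om -> continuous x ->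
  (forall e, 0 < e -> \forall n \near \oo, forall t, 0 <= t <= T ->
     `|x t - xn n t| <= e) ->
  forall e, 0 < e -> \forall n \near \oo, forall t, 0 <= t <= T ->
     `|G (om t) (x t) - G (om t) (xn n t)| <= e.
Proof.
move=> cG com cx xnx e e0.
have /compact_near_coveringP/near_covering_withinP K :
  compact (`[0, T]%classic : set R) by exact: segment_compact.
have {}K := K _ \oo (fun n t => `|G (om t) (x t) - G (om t) (xn n t)| <= e) _.
suff : \forall n \near \oo, `[0, T]%classic `<=`
    (fun t => `|G (om t) (x t) - G (om t) (xn n t)| <= e).
  by apply: filterS => n nK t tI; apply: nK; rewrite /= in_itv.
apply: K => t0 _.
have e20 : 0 < e / 2 by rewrite divr_gt0.
have cGt : {for (om t0, x t0), continuous (fun p : Omega * V => G p.1 p.2)} by exact: cG.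
move/cvgrPdist_le: cGt => /(_ _ e20) [[U W] /= [Uom Wx] UW].
have /nbhs_ballP[d /= d0 dW] := Wx.
have d20 : 0 < d / 2 by rewrite divr_gt0.
have n1 : \forall t \near t0, U (om t) by exact: (com _ _ Uom).
have cx0 : x t @[t --> t0] --> x t0 by exact: cx.
move/cvgrPdist_lt: cx0 => /(_ _ d20) n2.
exists ([set t | U (om t) /\ `|x t0 - x t| < d / 2],
        [set n | forall t, 0 <= t <= T -> `|x t - xn n t| <= d / 3]).
  split => /=; last by apply: xnx; rewrite divr_gt0.
  by apply: filterI; [exact: n1|exact: n2].
move=> [t n] /= [[Ut xt] xnt]; rewrite in_itv /= => tI.
have W1 : W (x t).
  by apply: dW; rewrite -ball_normE /ball_ /=; apply: lt_trans xt _; lra.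
have W2 : W (xn n t).
  apply: dW; rewrite -ball_normE /ball_ /=.
  rewrite -(subrKA (x t)) (le_lt_trans (ler_normD _ _))//.
  by have := xnt _ tI; lra.
have := UW (om t, x t) (conj Ut W1); have := UW (om t, xn n t) (conj Ut W2) => /=.
move=> h1 h2.
rewrite -(subrKA (G (om t0) (x t0))) (le_trans (ler_normD _ _))//.
by rewrite distrC; lra.
Qed.

(** * Continuous extension of a history to the whole line *)

Section Extension.
Context (R : realType) (r : R) (m : nat).

Lemma delay_clamp_subproof (hr : 0 < r) (t : R) : - r <= Num.min 0 (Num.max (- r) t) <= 0.
Proof. by rewrite ge_min lexx le_min oppr_le0 ltW//= le_max lexx. Qed.

Definition delay_clamp (hr : 0 < r) (t : R) : delay_itv r :=
  delay_pt (delay_clamp_subproof hr t).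

Lemma delay_clamp_val (hr : 0 < r) (s : delay_itv r) : delay_clamp hr (\val s) = s.
Proof.
apply: val_inj => /=; have /andP[s1 s2] := delay_itvP s.
by rewrite max_r// min_r.
Qed.

Lemma delay_clamp_continuous (hr : 0 < r) : continuous (delay_clamp hr).
Proof.
apply: continuous_comp_initial => t; rewrite /comp /=.
apply: continuous_min; first exact: (@cst_continuous _ _ (0 : R)).
by apply: continuous_max; [exact: (@cst_continuous _ _ (- r : R))|exact: cvg_id].
Qed.

(** Constant beyond both ends, hence continuous on the whole line: functions glued to it never reach
    the default value in [segment]. *)
Definition history_extension (hr : 0 < r) (phi : history r m) (t : R) : 'cV[R]_m :=
  phi (delay_clamp hr t).

Lemma history_extension_continuous (hr : 0 < r) phi :
  continuous (history_extension hr phi).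
Proof.
move=> t; apply: (@continuous_comp _ _ _ (delay_clamp hr) (fun s => phi s)).
  exact: delay_clamp_continuous.
by have /cts_historyP := history_cts phi; exact.
Qed.

Lemma segment_history_extension (hr : 0 < r) phi (y : R -> 'cV[R]_m) :
  continuous y -> (forall t, t <= 0 -> y t = history_extension hr phi t) ->
  segment r y 0 = phi.
Proof.
move=> cy y0; apply: history_ext => s; rewrite segmentE// add0r y0.
  by rewrite /history_extension delay_clamp_val.
by have /andP[] := delay_itvP s.
Qed.

Lemma history_extension_le (hr : 0 < r) phi t i :
  `|history_extension hr phi t i 0| <= `|phi|.
Proof. exact: le_trans (mx_entry_le _ _ _) (history_norm_ub _ _). Qed.

End Extension.

(* Here G(w, phi) = F(w, phi) - B phi(0), which is monotone and nonnegative on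
   the cone. *)
Section Existence.
Context (R : realType) (Omega : topologicalType) (r : R) (m : nat)
  (B : 'M[R]_m) (G : Omega -> history r m -> 'cV[R]_m) (hr : 0 < r).
Hypothesis qB : quasipositive B.
Hypothesis Gcont : continuous (fun p : Omega * history r m => G p.1 p.2).
Hypothesis Gmono : forall (w : Omega) (phi psi : history r m), exp_le B phi psi ->
  cv_le (G w phi) (G w psi).
Hypothesis Gpos : forall w phi, exp_cone B phi -> cv_le 0 (G w phi).
Context (C : R).
Hypothesis C0 : 0 <= C.
Hypothesis Ggrowth : forall w phi, exp_cone B phi -> forall i,
  G w phi i 0 <= C * (1 + `|phi|).
Context (om : R -> Omega) (psi : history r m).
Hypothesis com : continuous om.
Hypothesis psi0 : exp_cone B psi.

Let x0 := history_extension hr psi.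
Let cx0 : continuous x0. Proof. exact: history_extension_continuous. Qed.
Let b := mx_abs_sum B.

Let forcing (y : R -> 'cV[R]_m) (t : R) := G (om t) (segment r y t).

Let cforcing y : continuous y -> continuous (forcing y).
Proof. by move=> cy; exact: continuous_F_segment. Qed.

Let solves (g y : R -> 'cV[R]_m) := [/\ continuous y, forall t, t <= 0 -> y t = x0 t &
  forall t : R, 0 < t -> is_derive t 1 y (B *m y t + g t)].

(** Continuity of [g] is placed under the existential so that [solve] is total and the iteration
    carries no proofs. *)
Let solve_ex g : exists y, continuous g -> solves g y.
Proof.
have [cg|ncg] := pselect (continuous g); last by exists (fun=> 0) => /ncg.
have [y [_ [cy yl _ _ Dy]]] := linear_ivp_glue B 0 cg cx0.
by exists y.
Qed.

Let solve g := sval (cid (solve_ex g)).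

Let solveP g : continuous g -> solves g (solve g).
Proof. exact: svalP (cid (solve_ex g)). Qed.

Let it := fix it n := if n is n'.+1 then solve (forcing (it n')) else solve (fun=> 0).

(** The forcing of [it n]. It is zero at rank 0, so the first comparison, between ranks 0 and 1,
    only uses that G is nonnegative on the cone; later ones use that it is monotone. *)
Let itg n := if n is n'.+1 then forcing (it n') else (fun=> 0).

Let itP n : continuous (itg n) /\ solves (itg n) (it n).
Proof.
elim: n => [|n [_ [cn _ _]]].
  have c : continuous (fun _ : R => 0 : 'cV[R]_m) by exact: (@cst_continuous _ _ (0 : 'cV[R]_m)).
  by split => //; exact: solveP.
by split; [exact: cforcing|apply: solveP; exact: cforcing].
Qed.

Let cit n : continuous (it n). Proof. by have [_ []] := itP n. Qed.
Let it0 n t : t <= 0 -> it n t = x0 t.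
Proof. by have [_ [_ + _]] := itP n; exact. Qed.
Let Dit n (t : R) : 0 < t -> is_derive t 1 (it n) (B *m it n t + itg n t).
Proof. by have [_ [_ _]] := itP n; exact. Qed.

Let cone_of (y g : R -> 'cV[R]_m) : continuous y -> exp_cone B (segment r y 0) ->
  (forall t : R, 0 < t -> is_derive t 1 y (B *m y t + g t)) ->
  (forall t, 0 <= t -> cv_le 0 (g t)) ->
  forall t, 0 <= t -> exp_cone B (segment r y t).
Proof.
move=> cy y0 Dy g0 t t0.
apply: (exp_cone_propagation (dd := fun t => B *m y t + g t) qB cy y0 (T := t)).
- by move=> s /andP[/Dy].
- move=> s /andP[/ltW /g0 gs _] i; rewrite [leRHS]mxE lerDl.
  by have := gs i; rewrite mxE.
- by rewrite t0 lexx.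
Qed.

Let itcone n t : 0 <= t -> exp_cone B (segment r (it n) t).
Proof.
elim: n t => [|n IH] t t0.
  apply: (cone_of (g := itg 0)) => //; last by move=> s _ i; rewrite lexx.
    by rewrite (@segment_history_extension _ _ _ hr psi)// => s; exact: it0.
  by move=> s; exact: Dit.
apply: (cone_of (g := itg n.+1)) => //.
- by rewrite (@segment_history_extension _ _ _ hr psi)// => s; exact: it0.
- by move=> s; exact: Dit.
- by move=> s /IH; exact: Gpos.
Qed.

Let cB n p : continuous (fun t => it p t - it n t).
Proof. by move=> t; apply: cvgB; exact: cit. Qed.

Let DB n p (t : R) : 0 < t -> is_derive t 1 (fun t => it p t - it n t)
  (B *m (it p t - it n t) + (itg p t - itg n t)).
Proof.
move=> t0; have D1 := Dit n t0; have D2 := Dit p t0.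
by apply: (is_derive_eq (is_deriveB D2 D1)); rewrite mulmxBr opprD addrACA.
Qed.

Let itmonoS n t : 0 <= t -> exp_cone B (segment r (it n.+1) t - segment r (it n) t).
Proof.
have S0 p : exp_cone B (segment r (fun t => it p.+1 t - it p t) 0).
  suff -> : segment r (fun t => it p.+1 t - it p t) 0 = 0 by exact: exp_cone0.
  apply: history_ext => s; rewrite segmentE; last exact: cB.
  by have /andP[_ ?] := delay_itvP s; rewrite add0r !it0// subrr.
elim: n t => [|n IH] t t0; rewrite -segmentB//.
  apply: (cone_of (g := fun t => itg 1 t - itg 0 t)) => //.
    by move=> s; exact: DB.
  by move=> s s0; rewrite subr0; exact/Gpos/itcone.
apply: (cone_of (g := fun t => itg n.+2 t - itg n.+1 t)) => //.
  by move=> s; exact: DB.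
move=> s s0 i; rewrite cv_subE mxE subr_ge0; apply: Gmono; exact: IH.
Qed.

Let itmono n p t : (n <= p)%N -> 0 <= t ->
  exp_cone B (segment r (it p) t - segment r (it n) t).
Proof.
move=> /subnK <- t0; elim: (p - n)%N => [|k IH].
  by rewrite add0n subrr; exact: exp_cone0.
rewrite addSn -(subrKA (segment r (it (k + n)) t)).
apply: exp_coneD; last exact: IH.
exact: itmonoS.
Qed.

Let itmono_pt n p t : (n <= p)%N -> 0 <= t -> cv_le 0 (it p t - it n t).
Proof.
move=> np t0; have [+ _] := itmono np t0 => /(_ (delay0 hr)).
by rewrite historyBE !segment_delay0.
Qed.

Let itgmono n p t : (n <= p)%N -> 0 <= t -> cv_le 0 (itg p t - itg n t).
Proof.
move=> np t0 i; rewrite cv_subE mxE subr_ge0.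
case: p np => [|p]; first by rewrite leqn0 => /eqP ->.
case: n => [|n] np; first by have := Gpos (om t) (itcone p t0) i.
by apply: Gmono; exact: itmono.
Qed.

(** M e^(kap t) dominates every iterate: M is at least [|psi|], for the history, and at least 1, so
    that C (1 + |phi|) <= 2 C M e^(kap t) when |phi| <= M e^(kap t). The other part [b] of [kap]
    absorbs the linear term. *)
Let M := `|psi| + 1.
Let kap := b + 2 * C.

Let M1 : 1 <= M. Proof. by rewrite lerDr; exact: history_norm_ge0. Qed.
Let kap0 : 0 <= kap. Proof. by rewrite addr_ge0 ?mulr_ge0// mx_abs_sum_ge0. Qed.

Let itbound n t i : 0 <= t -> it n t i 0 <= M * expR (kap * t).
Proof.
have M0 : 0 <= M := le_trans ler01 M1.
pose z t := M * expR (kap * t).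
have z0 u : 0 <= z u by rewrite mulr_ge0 ?expR_ge0.
have zM u : 0 <= u -> M <= z u.
  by move=> u0; rewrite ler_peMr// -expR0 ler_expR mulr_ge0.
have x0M u j : `|x0 u j 0| <= M.
  by apply: le_trans (history_extension_le _ _ _ _) _; rewrite lerDl.
have Dz (u : R) : is_derive u 1 z (kap * z u).
  have D3 : is_derive u 1 (fun u => kap * u) kap.
    by apply: is_derive_eq; rewrite /GRing.scale/= mulr1.
  have D4 := @is_derive1_comp R expR (fun u => kap * u) u _ _ (is_derive_expR _) D3.
  have D5 := is_deriveM (is_derive_cst M u 1) D4.
  by apply: (is_derive_eq D5); rewrite /z /GRing.scale/=; ring.
have cz : continuous z by move=> u; exact: is_derive_continuous (Dz u).
have step k : (forall u, 0 < u -> forall j, itg k u j 0 <= 2 * C * z u) ->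
    forall u, 0 <= u -> forall j, it k u j 0 <= z u.
  move=> gk u u0 j.
  suff /(_ j) : cv_le 0 (const_mx (z u) - it k u) by rewrite !mxE subr_ge0.
  apply: (@linear_comparison _ _ B 0 u (fun u => const_mx (z u) - it k u) (fun u =>
      const_mx (kap * z u) - (B *m it k u + itg k u))) => //.
  - move=> v; apply: cvgB; last exact: cit.
    by apply/cv_cvgP => l; rewrite mxE; under eq_fun do rewrite mxE; exact: cz.
  - move=> v /andP[v0 _]; apply: is_deriveB; last exact: Dit.
    by apply/is_derive_cvP => l; rewrite mxE; under eq_fun do rewrite mxE; exact: Dz.
  - move=> v /andP[v0 _] l; rewrite mulmxBr !cv_subE.
    have -> : (B *m it k v + itg k v) l 0 = (B *m it k v) l 0 + itg k v l 0 by rewrite mxE.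
    rewrite opprD addrA [leRHS]addrAC lerD2r [X in _ <= X - _]mxE lerBrDr mulrDl.
    apply: lerD; last exact: gk.
    apply: le_trans (ler_norm _) _; apply: mulmx_cv_bound => j'.
    by rewrite mxE ger0_norm.
  - move=> l; rewrite cv_subE !mxE subr_ge0 (le_trans (ler_norm _))// it0//.
    by rewrite (le_trans (x0M _ _))// zM.
  - by rewrite u0 lexx.
elim: n t i => [|n IH] t i t0; apply: step => // u u0 j.
  by rewrite mxE !mulr_ge0.
have nb : `|segment r (it n) u| <= z u.
  apply: segment_norm_le => // s /andP[_ su] l.
  have [s0|s0] := leP s 0; first by rewrite it0// (le_trans (x0M _ _))// zM// ltW.
  have := itcone n (ltW s0) => -[/(_ (delay0 hr) l)].
  rewrite segment_delay0// mxE => it_ge0 _.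
  rewrite ger0_norm// (le_trans (IH _ _ (ltW s0)))// ler_wpM2l// ler_expR ler_wpM2l//.
apply: le_trans (Ggrowth _ (itcone n (ltW u0)) j) _.
have := ler_wpM2l C0 nb; have := ler_wpM2l C0 (le_trans M1 (zM _ (ltW u0))); lra.
Qed.

Let y (t : R) : 'cV[R]_m := \col_i limn (fun n => it n t i 0).

Let it_ndec t i : 0 <= t -> nondecreasing_seq (fun n => it n t i 0).
Proof.
move=> t0; apply/nondecreasing_seqP => n.
by have := itmono_pt (leqnSn n) t0 i; rewrite cv_subE mxE subr_ge0.
Qed.

Let it_cvg t i : it n t i 0 @[n --> \oo] --> y t i 0.
Proof.
rewrite mxE; have [t0|/ltW t0] := leP t 0.
  have E n : it n t i 0 = x0 t i 0 by rewrite it0.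
  by under eq_fun do rewrite E; rewrite lim_cst//; exact: cvg_cst.
have : cvgn (fun n => it n t i 0).
  apply: nondecreasing_is_cvgn; first exact: it_ndec.
  by exists (M * expR (kap * t)) => _ [n _ <-]; exact: itbound.
by [].
Qed.

Let y0 t : t <= 0 -> y t = x0 t.
Proof.
move=> t0; apply/matrixP => i j; rewrite ord1 mxE.
have E n : it n t i 0 = x0 t i 0 by rewrite it0.
by under eq_fun do rewrite E; rewrite lim_cst.
Qed.

Let y_ge n t i : it n t i 0 <= y t i 0.
Proof.
have [t0|/ltW t0] := leP t 0; first by rewrite y0// it0.
have := @nondecreasing_cvgn_le _ _ (it_ndec i t0) _ n; rewrite mxE; apply.
by have /cvgP := @it_cvg t i.
Qed.

(* The differences [it p - it n] lie in the cone, so up to an exponential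
   factor they are controlled by their value at the final time. *)
Let gap n s t i : 0 <= s <= t ->
  y s i 0 - it n s i 0 <= expR (b * (t - s)) * (y t i 0 - it n t i 0).
Proof.
move=> /andP[s0 st].
have c1 : it p s i 0 - it n s i 0 @[p --> \oo] --> y s i 0 - it n s i 0.
  by apply: cvgB; [exact: it_cvg|exact: cvg_cst].
have c2 : expR (b * (t - s)) * (it p t i 0 - it n t i 0) @[p --> \oo] -->
    expR (b * (t - s)) * (y t i 0 - it n t i 0).
  by apply: cvgMr; apply: cvgB; [exact: it_cvg|exact: cvg_cst].
apply: (ler_cvg_to c1 c2); near=> p.
have np : (n <= p)%N by near: p; exact: nbhs_infty_ge.
have := @decay_lower_bound _ _ B s t (fun t => it p t - it n t)
  (fun t => B *m (it p t - it n t) + (itg p t - itg n t)) i qB (@cB n p) _ _ _ t _.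
rewrite mulNr expRN -/b mulrC ler_pdivrMr ?expR_gt0// mulrC !cv_subE; apply.
- by move=> u /andP[su _]; apply: DB; exact: le_lt_trans su.
- move=> u /andP[su _] j; rewrite [leRHS]mxE lerDl.
  by have := itgmono np (le_trans s0 (ltW su)) j; rewrite mxE.
- exact: itmono_pt.
- by rewrite st lexx.
Unshelve. all: by end_near. Qed.

Let gap_norm n s T : s <= T -> 0 <= T ->
  `|y s - it n s| <= expR (b * T) * `|y T - it n T|.
Proof.
move=> sT T0; have E0 : 0 <= expR (b * T) * `|y T - it n T| by rewrite mulr_ge0 ?expR_ge0.
have [s0|/ltW s0] := leP s 0; first by rewrite y0// it0// subrr normr0.
apply: cv_norm_le => // i; rewrite cv_subE ger0_norm ?subr_ge0//.
apply: le_trans (@gap n s T i _) _; first by rewrite s0.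
have h := mx_entry_le (y T - it n T) i 0; rewrite cv_subE ger0_norm ?subr_ge0// in h.
apply: ler_pM; rewrite ?expR_ge0 ?subr_ge0// ler_expR ler_wpM2l ?mx_abs_sum_ge0//.
by rewrite gerBl.
Qed.

Let y_unif T e : 0 <= T -> 0 < e ->
  \forall n \near \oo, forall t, t <= T -> `|y t - it n t| <= e.
Proof.
move=> T0 e0.
have c : it n T @[n --> \oo] --> y T by apply/cv_cvgP => i; exact: it_cvg.
move/cvgrPdist_le: c => /(_ (e / expR (b * T))); rewrite divr_gt0 ?expR_gt0// => /(_ isT).
apply: filterS => n nT t tT; apply: le_trans (gap_norm n tT T0) _.
by rewrite mulrC -ler_pdivlMr ?expR_gt0.
Qed.

Let cy : continuous y.
Proof.
move=> t; apply/cvgrPdist_le => e e0.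
have e30 : 0 < e / 3 by rewrite divr_gt0.
have T0 : 0 <= `|t| + 1 by rewrite addr_ge0.
have /filter_ex[n nT] := y_unif T0 e30.
have ct : it n s @[s --> t] --> it n t by exact: cit.
move/cvgrPdist_le: ct => /(_ _ e30) ct.
near=> s.
have sT : s <= `|t| + 1.
  near: s; have : t < `|t| + 1 by rewrite (le_lt_trans (ler_norm t))// ltrDl.
  by move=> /lt_nbhsl; apply: filterS => s /ltW.
have h1 : `|it n t - it n s| <= e / 3 by near: s.
have h2 := nT _ sT.
have h3 : `|y t - it n t| <= e / 3 by apply: nT; rewrite (le_trans (ler_norm t))// lerDl.
have -> : y t - y s = (y t - it n t) + ((it n t - it n s) + (it n s - y s)).
  by rewrite !subrKA.
apply: le_trans (ler_normD _ _) _.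
have h4 := ler_normD (it n t - it n s) (it n s - y s).
have h5 : `|it n s - y s| <= e / 3 by rewrite distrC.
by lra.
Unshelve. all: by end_near. Qed.

Let segment_unif T e : 0 < e ->
  \forall n \near \oo, forall t, 0 <= t <= T ->
    `|segment r y t - segment r (it n) t| <= e.
Proof.
move=> e0; have [T0|T0] := leP 0 T; last first.
  near=> n => t /andP[t0 tT]; have := le_trans t0 tT; by rewrite leNgt T0.
have := y_unif T0 e0; apply: filterS => n nT t /andP[t0 tT].
rewrite -segmentB//; apply: segment_norm_le.
- by move=> u; apply: cvgB; [exact: cy|exact: cit].
- exact: ltW.
- move=> s /andP[_ st] i; apply: le_trans (mx_entry_le _ _ _) _; apply: nT.
  exact: le_trans tT.
Unshelve. all: by end_near. Qed.

(** No derivative is passed to the limit: [h] solves the linear equation with the forcing of the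
    limit [y], and [h - it n.+1] solves one with zero history and a forcing that tends uniformly to
    0. So the iterates also tend to [h], whence [h = y]. *)
Lemma delay_existence : exists y C : R -> 'cV[R]_m,
  [/\ continuous y, forall t, t <= 0 -> y t = history_extension hr psi t,
     forall t, 0 <= t -> y t = C t &
     forall t : R, 0 <= t ->
       is_derive t 1 C (B *m y t + G (om t) (segment r y t))].
Proof.
have cf := cforcing cy.
have [h [D [ch hl hr' DD Dh]]] := linear_ivp_glue B 0 cf cx0.
suff hy : h = y.
  exists y, D; split=> //; rewrite -?hy//.
  by move=> t t0; have := DD t t0; rewrite -hr'// hy.
apply/funext => t; have [t0|t0] := leP t 0; first by rewrite hl// y0.
apply/matrixP => i j; rewrite ord1 {j}.
have cyt : it n.+1 t i 0 @[n --> \oo] --> y t i 0.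
  by rewrite (cvg_shiftS (fun n => it n t i 0)); exact: it_cvg.
have cht : it n.+1 t i 0 @[n --> \oo] --> h t i 0.
  apply/cvgrPdist_le => e e0.
  (* The factor in [linear_bound] at time [t]: a forcing of size [e / c] moves the solution by at
     most [e]. *)
  set c := t * expR (b * t).
  have c0 : 0 < c by rewrite mulr_gt0 ?expR_gt0.
  have := uniform_cvg_comp Gcont com (segment_continuous cy) (@segment_unif t).
  move=> /(_ (e / c)); rewrite divr_gt0// => /(_ isT); apply: filterS => n nP.
  have := @linear_bound _ _ B 0 t (e / c) (fun t => h t - it n.+1 t)
    (fun t => forcing y t - forcing (it n) t) qB _ _ _ _ _ t _ i.
  rewrite cv_subE subr0 -/b -mulrA -/c divfK ?gt_eqF//; apply.
  - by move=> u; apply: cvgB; [exact: ch|exact: cit].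
  - move=> u /andP[u0 _]; have D1 := Dh _ u0; have D2 := Dit n.+1 u0.
    by apply: (is_derive_eq (is_deriveB D1 D2)); rewrite mulmxBr opprD addrACA.
  - by rewrite divr_ge0 ?ltW.
  - move=> u /andP[u0 ut] j; apply: le_trans (mx_entry_le _ _ _) _.
    by apply: nP; rewrite ltW.
  - by rewrite hl// it0// subrr.
  - by rewrite ltW//=.
have /cvg_lim <- // := cht.
by have /cvg_lim <- // := cyt.
Qed.

End Existence.

(** * From functions on the whole line to [is_global_solution] and back *)

Lemma cvg_is_derive (R : realType) (V : normedModType R) (f : R -> V) (t : R) (v : V) :
  h^-1 *: ((f \o shift t) (h *: 1) - f t) @[h --> 0^'] --> v -> is_derive t 1 f v.
Proof. by move=> fv; split; [apply/cvg_ex; exists v|exact: cvg_lim]. Qed.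

Lemma is_derive_cvg (R : realType) (V : normedModType R) (f : R -> V) (t : R) (v : V) :
  is_derive t 1 f v -> h^-1 *: ((f \o shift t) (h *: 1) - f t) @[h --> 0^'] --> v.
Proof. by move=> [df <-]; exact: df. Qed.

Lemma nonexpansive_continuous (R : realType) (V W : normedModType R) (f : V -> W) :
  (forall x y, `|f x - f y| <= `|x - y|) -> continuous f.
Proof.
move=> fL x; apply/cvgrPdist_le => e e0.
have c : y @[y --> x] --> x by exact: cvg_id.
by move/cvgrPdist_le: c => /(_ _ e0); apply: filterS => y; exact: le_trans.
Qed.

Lemma history_eval_continuous (R : realType) (r : R) m (s : delay_itv r) :
  continuous (fun phi : history r m => phi s).
Proof.
apply: nonexpansive_continuous => phi psi.
exact: (history_norm_ub (phi - psi) s).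
Qed.

Section GlobalSolutions.
Context (R : realType) (Omega : topologicalType) (r : R) (m : nat)
  (flow : R -> Omega -> Omega) (F : Omega -> history r m -> 'cV[R]_m) (hr : 0 < r).

(** The difference quotients allowed in [is_global_solution] only see times where [y] equals [C], so
    the two-sided derivative of [C] also settles [t = 0]. *)
Lemma global_solution_of_regular (w : Omega) (psi : history r m)
    (y C : R -> 'cV[R]_m) :
  continuous y -> (forall t, t <= 0 -> y t = history_extension hr psi t) ->
  (forall t, 0 <= t -> y t = C t) ->
  (forall t : R, 0 <= t -> is_derive t 1 C (F (flow t w) (segment r y t))) ->
  is_global_solution flow F w psi y.
Proof.
move=> cy y0 yC DC; split.
- exact: continuous_subspaceT.
- move=> s; have /andP[_ s0] := delay_itvP s.
  by rewrite y0// /history_extension delay_clamp_val.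
- move=> t t0; have := is_derive_cvg (DC t t0) => H.
  apply: (@cvg_trans _ (h^-1 *: ((C \o shift t) (h *: 1) - C t)
      @[h --> within [set h | 0 <= t + h] 0^'])).
    apply: near_eq_cvg; rewrite near_withinE; near=> h => /= th.
    by rewrite [h *: 1]mulr1 [h + t]addrC -!yC.
  by apply: cvg_trans H; apply: cvg_app; exact: cvg_within.
Unshelve. all: by end_near. Qed.

(** A global solution is arbitrary before [- r]. Freezing it there at its value in [- r] makes it
    continuous everywhere and keeps all segments at nonnegative times; for [t > 0] the constraint
    [0 <= t + h] holds for all small [h]. *)
Lemma global_solution_regular (w : Omega) (psi : history r m) (y : R -> 'cV[R]_m) :
  is_global_solution flow F w psi y ->
  exists z : R -> 'cV[R]_m, [/\ continuous z, segment r z 0 = psi,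
    forall t, 0 <= t -> segment r z t = segment r y t &
    forall t : R, 0 < t -> is_derive t 1 z (F (flow t w) (segment r z t))].
Proof.
move=> [cy y0 Dy].
pose z t := y (Num.max (- r) t).
have zy t : - r <= t -> z t = y t by move=> rt; rewrite /z max_r.
have cz : continuous z.
  have cm : continuous (fun x : R => Num.max (- r) x).
    move=> x; apply: (@continuous_max _ _ (fun=> - r) id x); last exact: cvg_id.
    exact: cst_continuous.
  have mA x : `[- r, +oo[%classic (Num.max (- r) x).
    by rewrite /= in_itv /= andbT le_max lexx.
  move=> t; have /subspace_continuousP/(_ _ (mA t)) cyt := cy.
  move=> P /cyt yP; have yP' : \forall x \near t,
    `[- r, +oo[%classic (Num.max (- r) x) -> P (z x) by exact: (cm t _ yP).
  have : \forall x \near t, P (z x) by apply: filterS yP' => x; apply; exact: mA.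
  exact.
have seg t : 0 <= t -> segment r z t = segment r y t.
  move=> t0; rewrite /segment; congr insubd; apply/funext => s; apply: zy.
  by have /andP[? _] := delay_itvP s; lra.
exists z; split => //.
- apply: history_ext => s; rewrite segmentE// add0r zy ?y0//.
  by have /andP[] := delay_itvP s.
- move=> t t0; rewrite seg ?ltW//; apply: cvg_is_derive.
  move=> P /(Dy t (ltW t0)); rewrite !near_simpl near_withinE => yP.
  have t0' : \forall h \near (0 : R)^', 0 <= t + h.
    apply: nbhs_dnbhs; have : - t < 0 by rewrite oppr_lt0.
    by move=> /lt_nbhsr; apply: filterS => h; rewrite -subr_gt0 opprK addrC => /ltW.
  have : \forall h \near (0 : R)^', 0 <= t + h /\ P (h^-1 *: (y (t + h) - y t)).
    by near=> h; have th : 0 <= t + h; [near: h|split=> //; move: th; near: h].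
  apply: filterS => h [th]; rewrite /= [h *: 1]mulr1 [h + t]addrC.
  have rx x : 0 <= x -> - r <= x by move: hr => + x0; lra.
  by rewrite !zy ?rx// ltW.
Unshelve. all: by end_near. Qed.

End GlobalSolutions.

(** F is bounded above by some [C] on the unit ball. If [|psi| > 1], sublinearity with factor
    1/|psi| gives F(psi) / |psi| <= F(psi / |psi|) <= C. *)
Lemma sublinear_growth (R : realType) (Omega : topologicalType) (r : R) (m : nat)
    (B : 'M[R]_m) (F : Omega -> history r m -> 'cV[R]_m) :
  (forall X1 : set (history r m), bounded_set X1 ->
     bounded_set [set F w phi | w in [set: Omega] & phi in X1]) ->
  (forall (w : Omega) (psi : history r m) (lam : R),
     exp_le B 0 psi -> 0 <= lam <= 1 ->
     cv_le (lam *: F w psi) (F w (lam *: psi))) ->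
  exists2 C : R, 0 <= C & forall w psi, exp_cone B psi -> forall i,
    F w psi i 0 <= C * (1 + `|psi|).
Proof.
move=> Fbound Fsub.
have /Fbound[M [_ FM]] : bounded_set [set phi : history r m | `|phi| <= 1].
  by exists 1; split => // x x1 phi /= /le_trans; apply; exact: ltW.
pose C := `|M| + 1.
have C0 : 0 <= C by rewrite addr_ge0.
have FC w phi : `|phi| <= 1 -> forall i, F w phi i 0 <= C.
  move=> phi1 i; apply: le_trans (ler_norm _) _; apply: le_trans (mx_entry_le _ _ _) _.
  apply: (FM C); first by rewrite (le_lt_trans (ler_norm M))// ltrDl.
  by exists w => //; exists phi.
exists C => // w psi psi0 i.
have n0 : 0 <= `|psi| by exact: history_norm_ge0.
have [psi1|psi1] := leP `|psi| 1.
  by apply: le_trans (FC _ _ psi1 i) _; rewrite ler_peMr// lerDl.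
have pgt0 : 0 < `|psi| := lt_trans ltr01 psi1.
have l01 : 0 <= `|psi|^-1 <= 1 by rewrite invr_ge0 n0 invf_le1// ltW.
have psi0' : exp_le B 0 psi by rewrite /exp_le subr0.
have := Fsub w psi _ psi0' l01 i; rewrite mxE => h1.
have h2 : F w (`|psi|^-1 *: psi) i 0 <= C.
  apply: FC; rewrite [leLHS](history_normZ (`|psi|^-1) psi).
  by rewrite ger0_norm ?invr_ge0// mulVf// gt_eqF.
have := le_trans h1 h2; rewrite ler_pdivrMl// mulrC => /le_trans; apply.
by rewrite ler_wpM2l// lerDr.
Qed.

(** Sublinearity for a zero history and a zero factor. *)
Lemma delay_field_ge0 (R : realType) (Omega : topologicalType) (r : R) (m : nat)
    (B : 'M[R]_m) (F : Omega -> history r m -> 'cV[R]_m) :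
  (forall (w : Omega) (psi : history r m) (lam : R),
     exp_le B 0 psi -> 0 <= lam <= 1 ->
     cv_le (lam *: F w psi) (F w (lam *: psi))) ->
  forall w, cv_le 0 (F w 0).
Proof.
move=> Fsub w; have e0 : exp_le B (0 : history r m) 0.
  by rewrite /exp_le subr0; exact: exp_cone0.
have l0 : 0 <= (0 : R) <= 1 by rewrite lexx ler01.
by have := Fsub w 0 0 e0 l0; rewrite !scale0r.
Qed.

Theorem proposition3p1 (R : realType) (Omega : metricType R)
    (flow : R -> Omega -> Omega) (r : R) (m : nat) (B : 'M[R]_m)
    (F : Omega -> history r m -> 'cV[R]_m)
    (hOmega : compact [set: Omega])
    (hflow : continuous_flow flow) (hmin : minimal_flow flow)
    (hr : 0 < r) (hm : (1 <= m)%N) (hB : quasipositive B)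
    (Fcont : continuous (fun p : Omega * history r m => F p.1 p.2))
    (FC1 : C1_snd F)
    (Fbound : forall X1 : set (history r m), bounded_set X1 ->
       bounded_set [set F w phi | w in [set: Omega] & phi in X1])
    (Fmono : forall (w : Omega) (phi psi : history r m), exp_le B phi psi ->
       cv_le (B *m (psi (delay0 hr) - phi (delay0 hr))) (F w psi - F w phi))
    (Fsub : forall (w : Omega) (psi : history r m) (lam : R),
       exp_le B 0 psi -> 0 <= lam <= 1 ->
       cv_le (lam *: F w psi) (F w (lam *: psi))) :
  (forall (w : Omega) (psi : history r m), exp_cone B psi ->
     exists y : R -> 'cV[R]_m, is_global_solution flow F w psi y) /\
  (forall (w : Omega) (psi : history r m) (lam : R) (y z : R -> 'cV[R]_m),
     exp_le B 0 psi -> 0 <= lam <= 1 ->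
     is_global_solution flow F w psi y ->
     is_global_solution flow F w (lam *: psi) z ->
     forall t : R, 0 <= t ->
       exp_le B (lam *: segment r y t) (segment r z t)).

Proof.
have cflow w : continuous (fun t => flow t w).
  have [cf _ _] := hflow; move=> t.
  apply: (@continuous_comp _ _ _ (fun t => (t, w)) (fun p : R * Omega => flow p.1 p.2)).
    have h1 : s @[s --> t] --> t by exact: cvg_id.
    have h2 : w @[_ --> t] --> w by exact: (@cst_continuous _ _ w).
    exact: cvg_pair h1 h2.
  exact: cf.
have F0 := delay_field_ge0 Fsub.
split=> [w psi psi0|w psi lam y z psi0 lam01 ysol zsol t t0].
  pose G v (phi : history r m) := F v phi - B *m phi (delay0 hr).
  have Gcont : continuous (fun p : Omega * history r m => G p.1 p.2).
    move=> p; apply: cvgB; first exact: Fcont.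
    have cB : continuous (fun v : 'cV[R]_m => B *m v).
      by apply: continuous_mulmx => [i j|v]; [exact: cst_continuous|exact: cvg_id].
    apply: (@continuous_comp _ _ _ (fun p : Omega * history r m => p.2 (delay0 hr))
      (fun v => B *m v)); last exact: cB.
    apply: (@continuous_comp _ _ _ snd (fun phi : history r m => phi (delay0 hr))).
      exact: cvg_snd.
    exact: history_eval_continuous.
  have Gmono v (phi chi : history r m) : exp_le B phi chi -> cv_le (G v phi) (G v chi).
    move=> /(Fmono v) H i; have := H i; rewrite mulmxBr !cv_subE; lra.
  have Gpos v (phi : history r m) : exp_cone B phi -> cv_le 0 (G v phi).
    move=> phi0; have e0 : exp_le B 0 phi by rewrite /exp_le subr0.
    move=> i; apply: le_trans (Gmono v _ _ e0 i).
    rewrite cv_subE -[(0 : history r m) _]/(0 : 'cV[R]_m) mulmx0.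
    by have := F0 v i; rewrite [(0 : 'cV[R]_m) i 0]mxE subr0.
  have [C C0 FC] := sublinear_growth Fbound Fsub.
  have CB0 : 0 <= C + mx_abs_sum B by rewrite addr_ge0 ?mx_abs_sum_ge0.
  (* The term - B phi(0) costs at most [mx_abs_sum B] times [|phi|]. *)
  have Ggrowth v (phi : history r m) : exp_cone B phi -> forall i,
      G v phi i 0 <= (C + mx_abs_sum B) * (1 + `|phi|).
    move=> phi0 i; rewrite cv_subE mulrDl; apply: lerD; first exact: FC.
    apply: le_trans (ler_norm _) _; rewrite normrN; apply: mulmx_cv_bound => j.
    apply: le_trans (mx_entry_le _ _ _) _.
    by apply: le_trans (history_norm_ub _ _) _; rewrite lerDr.
  have [y [D [cy y0 yD DD]]] :=
    delay_existence hr hB Gcont Gmono Gpos CB0 Ggrowth (cflow w) psi0.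
  exists y; apply: (global_solution_of_regular (hr := hr) cy y0 yD) => t t0.
  apply: (is_derive_eq (DD t t0)).
  by rewrite /G segment_delay0// addrC subrK.
have [y' [cy y0 yE Dy]] := global_solution_regular hr ysol.
have [z' [cz z0 zE Dz]] := global_solution_regular hr zsol.
rewrite /exp_le -zE// -yE//.
have psic : exp_cone B psi by move: psi0; rewrite /exp_le subr0.
(* The zero function serves both as the sub-solution and as its derivative; [F0] is its differential
   inequality. *)
have c0 : continuous (fun _ : R => 0 : 'cV[R]_m) by exact: cst_continuous.
have sy s : 0 <= s -> exp_cone B (segment r y' s).
  have seg0 u : segment r (fun u => y' u - 0) u = segment r y' u.
    by congr segment; apply/funext => v; rewrite subr0.
  move=> s0; rewrite -seg0.
  apply: (delay_comparison hB Fcont FC1 Fmono (cflow w) c0 cy c0 _ Dy) => //.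
  - move=> u u0 i; rewrite (_ : segment r _ u = 0); first exact: F0.
    by apply: history_ext => v; rewrite segmentE.
  - by rewrite seg0 y0.
have cly : continuous (fun u => lam *: y' u) by move=> u; apply: cvgZl_tmp; exact: cy.
rewrite -segmentZ// -segmentB//.
(* Sublinearity may be applied along [y'] because [sy] keeps its segments in the cone; the initial
   difference of the two histories is zero. *)
apply: (delay_comparison hB Fcont FC1 Fmono (cflow w) cly cz
  (a := fun u => lam *: F (flow u w) (segment r y' u))).
- by move=> u; apply: cvgZl_tmp; exact: continuous_F_segment.
- by move=> u /Dy Dyu; exact: is_deriveZ.
- move=> u u0; rewrite (segmentZ r lam u cy); apply: Fsub; last exact: lam01.
  by rewrite /exp_le subr0; exact: sy.
- by rewrite segmentB// segmentZ// z0 y0 subrr; exact: exp_cone0.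
- exact: t0.
Qed.
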